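(* Let $R$ be a commutative Noetherian ring with non-zero identity, $\mathfrak a$ an ideal of $R$, $M$ a finitely generated $R$-module, $X$ an arbitrary $R$-module and $n$ a non-negative integer. Then: (a) $\operatorname{Supp}_R(H^n_{\mathfrak a}(M,X))\subseteq\displaystyle\bigcup_{i\le n}\operatorname{Supp}_R\big(\operatorname{Ext}^{n-i}_R(M,H^i_{\mathfrak a}(X))\big)$. (b) $\displaystyle\bigcup_{i\le n}\operatorname{Supp}_R(H^i_{\mathfrak a}(M,X))\subseteq\bigcup_{i\le n}\operatorname{Supp}_R(H^i_{\mathfrak a}(X))$. In particular, $\operatorname{Supp}_R(H^n_{\mathfrak a}(M,X))\subseteq\displaystyle\bigcup_{i\le\operatorname{cd}_R(\mathfrak a,X)}\operatorname{Supp}_R(H^i_{\mathfrak a}(X))$.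
   Context: $H^i_{\mathfrak a}(M,X)=\varinjlim_{k}\operatorname{Ext}^i_R(M/\mathfrak a^kM,X)$ is the $i$-th generalized local cohomology module, and $H^i_{\mathfrak a}(X)=H^i_{\mathfrak a}(R,X)$ is ordinary local cohomology. $\operatorname{cd}_R(\mathfrak a,X)$, the cohomological dimension of $X$ with respect to $\mathfrak a$, is the largest integer $i$ with $H^i_{\mathfrak a}(X)\ne 0$. *)

(* Defs.v *)
From HB Require Import structures.
From mathcomp Require Import all_boot all_order all_algebra.
From mathcomp Require Import boolp classical_sets functions constructive_ereal.
From mathcomp Require Import ring freeg.
Set Implicit Arguments.
Unset Strict Implicit.
Unset Printing Implicit Defensive.
Import GRing.Theory.
Local Open Scope classical_set_scope.
Local Open Scope ring_scope.
Local Open Scope quotient_scope.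

(* A submodule of V is a V-predicate of type submodClosed V; in particular an
   ideal of R, not necessarily proper, is a submodClosed R^o.  (The structure
   idealr of ring_quotient.v only covers proper ideals.) *)

Section Span.
Variables (R : comNzRingType) (V : lmodType R).

Definition spanm (G : set V) : {pred V} := fun x =>
  `[< exists s : seq (R * V),
        (forall c, c \in s -> G c.2) /\ x = \sum_(c <- s) c.1 *: c.2 >].

Lemma spanm_closed G : submod_closed (spanm G).
Proof.
split; first by apply/asboolP; exists [::]; rewrite big_nil.
move=> a x y /asboolP[s [sG ->]] /asboolP[t [tG ->]]; apply/asboolP.
exists ([seq (a * c.1, c.2) | c <- s] ++ t); split=> [c|].
  by rewrite mem_cat => /orP[/mapP[d ds ->]|/tG//]; exact: (sG d).
rewrite big_cat/= big_map scaler_sumr; congr (_ + _).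
by apply: eq_bigr => c _; rewrite scalerA.
Qed.
HB.instance Definition _ G :=
  GRing.isSubmodClosed.Build R V (spanm G) (spanm_closed G).

Definition fin_gen (N : {pred V}) :=
  exists s : seq V, N =i spanm [set` s].

End Span.

Definition noetherian (R : comNzRingType) :=
  forall I : submodClosed R^o, fin_gen I.

Definition fin_gen_module (R : comNzRingType) (M : lmodType R) :=
  fin_gen (predT : {pred M}).

Section SubQuotient.
Variable R : comNzRingType.

Definition subm (V : lmodType R) (S : submodClosed V) := {x : V | x \in S}.
HB.instance Definition _ V S := SubChoice.on (@subm V S).
HB.instance Definition _ V S := [SubChoice_isSubLmodule of @subm V S by <:].

(* Quotient.quot expects a zmodClosed; a submodClosed predicate is closed under
   opposite, but the library does not infer it. *)
Definition zsub (V : lmodType R) (S : submodClosed V) : {pred V} := S.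

Lemma zsub_closed V S : zmod_closed (@zsub V S).
Proof. exact: submodClosedP. Qed.
HB.instance Definition _ (V : lmodType R) (S : submodClosed V) :=
  GRing.isZmodClosed.Build V (@zsub V S) (zsub_closed S).

Definition quotm (V : lmodType R) (S : submodClosed V) :=
  Quotient.quot (zsub S).
HB.instance Definition _ V S := GRing.Zmodule.on (@quotm V S).

Definition pim (V : lmodType R) (S : submodClosed V) (x : V) : quotm S :=
  \pi_(Quotient.quot (zsub S)) x.

Section Scale.
Variables (V : lmodType R) (S : submodClosed V).

Lemma pimE x y : (pim S x = pim S y) <-> (x - y \in S).
Proof.
have E := Quotient.idealrBE (zsub S) x y; split=> [e|e].
  by change (is_true (x - y \in zsub S)); rewrite E; apply/eqP.
by change (is_true (x - y \in zsub S)) in e; apply/eqP; rewrite E in e.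
Qed.

Lemma pim_ind (P : quotm S -> Prop) : (forall x, P (pim S x)) -> forall q, P q.
Proof. by move=> Px q; rewrite -[q](@reprK _ (Quotient.quot (zsub S))); apply: Px. Qed.

Lemma repr_pim x : repr (pim S x) - x \in S.
Proof. by apply/pimE; rewrite /pim reprK. Qed.

Lemma pimD x y : pim S (x + y) = pim S x + pim S y.
Proof. exact: (raddfD (\pi_(Quotient.quot (zsub S)))). Qed.

Definition scaleq (a : R) (q : quotm S) : quotm S := pim S (a *: repr q).

Lemma scaleq_pim a x : scaleq a (pim S x) = pim S (a *: x).
Proof. by apply/pimE; rewrite -scalerBr rpredZ// repr_pim. Qed.

Lemma scaleqA a b q : scaleq a (scaleq b q) = scaleq (a * b) q.
Proof. by elim/pim_ind: q => x; rewrite !scaleq_pim scalerA. Qed.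

Lemma scale1q : left_id 1 scaleq.
Proof. by elim/pim_ind => x; rewrite scaleq_pim scale1r. Qed.

Lemma scaleqDr : right_distributive scaleq +%R.
Proof.
move=> a; elim/pim_ind => x; elim/pim_ind => y.
by rewrite -pimD !scaleq_pim scalerDr pimD.
Qed.

Lemma scaleqDl q : {morph scaleq^~ q : a b / a + b}.
Proof. by move=> a b; elim/pim_ind: q => x; rewrite !scaleq_pim scalerDl pimD. Qed.

HB.instance Definition _ := GRing.Zmodule_isLmodule.Build R (quotm S)
  scaleqA scale1q scaleqDr scaleqDl.

Lemma pim_is_linear : linear (pim S).
Proof. by move=> a x y; rewrite pimD -scaleq_pim. Qed.
HB.instance Definition _ := GRing.isLinear.Build R V (quotm S) _ (pim S)
  pim_is_linear.

End Scale.

Section Maps.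
Variables (U V : lmodType R) (f : {linear U -> V}).
Variables (S : submodClosed U) (T : submodClosed V).
Hypothesis fST : forall x, x \in S -> f x \in T.

Definition subm_map (x : subm S) : subm T := Sub (f (val x)) (fST (valP x)).

Lemma subm_map_is_linear : linear subm_map.
Proof. by move=> a x y; apply: val_inj; rewrite /= linearP. Qed.
HB.instance Definition _ := GRing.isLinear.Build R (subm S) (subm T) _ subm_map
  subm_map_is_linear.

(* The hypothesis fST is an argument of quotm_map, although it is only used to
   show that the result is linear. *)
Definition quotm_map (_ : forall x, x \in S -> f x \in T) (q : quotm S) :
  quotm T := pim T (f (repr q)).

Lemma quotm_map_pim x : quotm_map fST (pim S x) = pim T (f x).
Proof. by apply/pimE; rewrite -linearB fST// repr_pim. Qed.

Lemma quotm_map_is_linear : linear (quotm_map fST).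
Proof.
move=> a; elim/pim_ind => x; elim/pim_ind => y.
by rewrite -linearP !quotm_map_pim !linearP.
Qed.
HB.instance Definition _ := GRing.isLinear.Build R (quotm S) (quotm T) _
  (quotm_map fST)
  quotm_map_is_linear.

End Maps.

Definition kerp (U V : lmodType R) (f : {linear U -> V}) : {pred U} :=
  fun x => f x == 0.

Lemma kerp_closed U V f : submod_closed (@kerp U V f).
Proof.
split; first by rewrite unfold_in linear0.
by move=> a x y; rewrite !unfold_in => /eqP fx /eqP fy;
  rewrite linearP fx fy scaler0 addr0.
Qed.
HB.instance Definition _ U V f :=
  GRing.isSubmodClosed.Build R U (@kerp U V f) (kerp_closed f).

Definition imp (U V : lmodType R) (f : {linear U -> V}) : {pred V} :=
  fun y => `[< exists x, f x = y >].

Lemma imp_closed U V f : submod_closed (@imp U V f).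
Proof.
split; first by apply/asboolP; exists 0; rewrite linear0.
move=> a x y /asboolP[u <-] /asboolP[v <-]; apply/asboolP.
by exists (a *: u + v); rewrite linearP.
Qed.
HB.instance Definition _ U V f :=
  GRing.isSubmodClosed.Build R V (@imp U V f) (imp_closed f).

Definition preimp (U V : lmodType R) (f : {linear U -> V})
  (S : submodClosed V) : {pred U} := fun x => f x \in S.

Lemma mem_preimp U V f S x : (x \in @preimp U V f S) = (f x \in S).
Proof. by []. Qed.

Lemma preimp_closed U V f S : submod_closed (@preimp U V f S).
Proof.
split; first by rewrite mem_preimp linear0 rpred0.
by move=> a x y; rewrite !mem_preimp => fx fy; rewrite linearP rpredD ?rpredZ.
Qed.
HB.instance Definition _ U V f S :=
  GRing.isSubmodClosed.Build R U (@preimp U V f S) (preimp_closed f S).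

End SubQuotient.

Section Hom.
Variable R : comNzRingType.

Definition linearp (U V : lmodType R) : {pred U -> V} := fun f => `[< linear f >].

Lemma linearp_closed U V : submod_closed (@linearp U V).
Proof.
split.
  by apply/asboolP => a x y; rewrite /= scaler0 addr0.
move=> a f g /asboolP lf /asboolP lg; apply/asboolP => b x y.
rewrite addrfctE scalrfctE lf lg !scalerDr !scalerA [b * a]mulrC.
by rewrite addrACA.
Qed.
HB.instance Definition _ (U V : lmodType R) :=
  GRing.isSubmodClosed.Build R (U -> V) (@linearp U V) (@linearp_closed U V).

Definition Hom (U V : lmodType R) : lmodType R := subm (@linearp U V).

Lemma precomp_subproof (U U' V : lmodType R) (g : {linear U' -> U})
  (f : Hom U V) : linearp (val f \o g).
Proof.
have /asboolP lf := valP f; apply/asboolP => a x y.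
by rewrite /= linearP lf.
Qed.

Definition precomp (U U' V : lmodType R) (g : {linear U' -> U}) (f : Hom U V) :
  Hom U' V := Sub (val f \o g) (precomp_subproof g f).

Lemma precomp_is_linear U U' V g : linear (@precomp U U' V g).
Proof. by move=> a f f'; apply: val_inj. Qed.
HB.instance Definition _ (U U' V : lmodType R) (g : {linear U' -> U}) :=
  GRing.isLinear.Build R (Hom U V) (Hom U' V) _ (precomp g)
    (precomp_is_linear g).

End Hom.

Section Cohomology.
Variable R : comNzRingType.

Definition zerop (V : lmodType R) : {pred V} := pred1 0.

Lemma zerop_closed V : submod_closed (@zerop V).
Proof.
split; first by rewrite unfold_in.
move=> a x y; rewrite !unfold_in => /eqP-> /eqP->.
by rewrite scaler0 addr0.
Qed.
HB.instance Definition _ (V : lmodType R) :=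
  GRing.isSubmodClosed.Build R V (@zerop V) (@zerop_closed V).

Section Complex.
Variables (C : nat -> lmodType R) (d : forall i, {linear C i -> C i.+1}).

Definition cocycles (i : nat) : lmodType R := subm (kerp (d i)).

Definition coboundary (i : nat) : submodClosed (C i) :=
  match i with 0 => @zerop (C 0) | j.+1 => imp (d j) end.

Definition cohomology (i : nat) : lmodType R :=
  quotm (preimp (val : {linear cocycles i -> C i}) (coboundary i)).

End Complex.

Section ChainMap.
Variables (C D : nat -> lmodType R).
Variables (c : forall i, {linear C i -> C i.+1}).
Variables (d : forall i, {linear D i -> D i.+1}).
Variables (phi : forall i, {linear C i -> D i}).
Hypothesis phiE : forall i x, d i (phi i x) = phi i.+1 (c i x).

Lemma cocycles_map_subproof i x : x \in kerp (c i) -> phi i x \in kerp (d i).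
Proof. by rewrite !unfold_in phiE => /eqP->; rewrite linear0. Qed.

Definition cocycles_map i : {linear cocycles c i -> cocycles d i} :=
  subm_map (@cocycles_map_subproof i).

Lemma cohomology_map_subproof i x :
  x \in preimp (val : {linear cocycles c i -> C i}) (coboundary c i) ->
  cocycles_map i x \in
    preimp (val : {linear cocycles d i -> D i}) (coboundary d i).
Proof.
rewrite !mem_preimp /=; case: i x => [|i] x /=.
  by rewrite !unfold_in => /eqP->; rewrite linear0.
by move=> /asboolP[y <-]; apply/asboolP; exists (phi i y); rewrite phiE.
Qed.

Definition cohomology_map i : {linear cohomology c i -> cohomology d i} :=
  quotm_map (@cohomology_map_subproof i).

End ChainMap.

End Cohomology.

(* Ext is computed with the standard functorial free resolution of M: the free
   module on the underlying set of M maps onto M, and one iterates with the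
   kernel.  Functoriality in M is strict, which gives the transition maps of the
   direct system defining generalized local cohomology. *)
Section Resolution.
Variable R : comNzRingType.

Definition freemod (K : choiceType) : lmodType R := {freeg K / R}.

Lemma fglift_is_linear (K : choiceType) (M : lmodType R) (f : K -> M) :
  linear (fglift f : freemod K -> M).
Proof.
have fD := @lift_is_additive R K M f.
pose F : {additive freemod K -> M} :=
  HB.pack (fglift f) (GRing.isZmodMorphism.Build _ _ _ fD).
suff FZ a x : F (a *: x) = a *: F x.
  move=> a x y; rewrite -[LHS]/(F _) raddfD.
  by congr (_ + _); apply: FZ.
have FE D : F D = \sum_(z <- dom D) coeff z D *: f z.
  rewrite -[in LHS](freeg_sumE D) raddf_sum.
  by apply: eq_bigr => z _; apply: liftU.
rewrite [a *: x]/(fgscale a x) raddf_sum FE scaler_sumr.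
by apply: eq_bigr => z _; rewrite scalerA; apply: liftU.
Qed.

Definition freelift (K : choiceType) (M : lmodType R) (f : K -> M) :
  freemod K -> M := fglift f.
HB.instance Definition _ (K : choiceType) (M : lmodType R) (f : K -> M) :=
  GRing.isLinear.Build R (freemod K) M _ (freelift f) (fglift_is_linear f).

Lemma freeliftU (K : choiceType) (M : lmodType R) (f : K -> M) k x :
  freelift f << k *g x >> = k *: f x.
Proof. exact: liftU. Qed.

Definition freemap (K L : choiceType) (f : K -> L) :
  {linear freemod K -> freemod L} := freelift (fun x => << f x >>).

Definition augmentation (M : lmodType R) : {linear freemod M -> M} := freelift id.

Lemma aug_freemap (M N : lmodType R) (f : {linear M -> N}) x :
  augmentation N (freemap f x) = f (augmentation M x).
Proof.
rewrite -[x]freeg_sumE !raddf_sum; apply: eq_bigr => z _ /=.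
by rewrite !freeliftU !linearZ /= freeliftU scale1r.
Qed.

Fixpoint syzygy (M : lmodType R) (n : nat) : lmodType R :=
  if n is m.+1 then subm (kerp (augmentation (syzygy M m))) else M.

Definition res (M : lmodType R) (n : nat) : lmodType R := freemod (syzygy M n).

Definition res_diff (M : lmodType R) (n : nat) :
  {linear res M n.+1 -> res M n} :=
  (val : {linear syzygy M n.+1 -> res M n}) \o augmentation (syzygy M n.+1).

Lemma syz_map_subproof (M N : lmodType R) (f : {linear M -> N}) x :
  x \in kerp (augmentation M) -> freemap f x \in kerp (augmentation N).
Proof. by rewrite !unfold_in aug_freemap => /eqP->; rewrite linear0. Qed.

Fixpoint syz_map (M N : lmodType R) (f : {linear M -> N}) (n : nat) :
  {linear syzygy M n -> syzygy N n} :=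
  if n is m.+1 then subm_map (@syz_map_subproof _ _ (syz_map f m)) else f.

Definition res_map (M N : lmodType R) (f : {linear M -> N}) (n : nat) :
  {linear res M n -> res N n} := freemap (syz_map f n).

Lemma res_diff_map (M N : lmodType R) (f : {linear M -> N}) n x :
  res_diff N n (res_map f n.+1 x) = res_map f n (res_diff M n x).
Proof. by rewrite /res_diff /= aug_freemap. Qed.

End Resolution.

Section Ext.
Variables (R : comNzRingType).

Definition Ext_cochain (M X : lmodType R) (i : nat) : lmodType R :=
  Hom (res M i) X.

Definition Ext_diff (M X : lmodType R) (i : nat) :
  {linear Ext_cochain M X i -> Ext_cochain M X i.+1} := precomp (res_diff M i).

Definition Ext (i : nat) (M X : lmodType R) : lmodType R :=
  cohomology (Ext_diff M X) i.

Lemma Ext_map_subproof (M N X : lmodType R) (f : {linear M -> N}) i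
  (u : Ext_cochain N X i) :
  Ext_diff M X i (precomp (res_map f i) u) =
  precomp (res_map f i.+1) (Ext_diff N X i u).
Proof.
apply: val_inj; apply/funext => x.
exact: (congr1 (val u) (esym (res_diff_map f x))).
Qed.

Definition Ext_map (i : nat) (M N X : lmodType R) (f : {linear M -> N}) :
  {linear Ext i N X -> Ext i M X} :=
  cohomology_map (@Ext_map_subproof M N X f) i.

End Ext.

Section DirectLimit.
Variable R : comNzRingType.
Variable N : nat -> lmodType R.

Definition dprod := forall k, N k.
HB.instance Definition _ := Choice.on dprod.

Let add (u v : dprod) : dprod := fun k => u k + v k.
Let opp (u : dprod) : dprod := fun k => - u k.
Let zero : dprod := fun k => 0.
Let scale (a : R) (u : dprod) : dprod := fun k => a *: u k.

Let dprodP (u v : dprod) : (forall k, u k = v k) -> u = v.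
Proof. exact: functional_extensionality_dep. Qed.

Let addA : associative add.
Proof. by move=> u v w; apply: dprodP => k; rewrite /add addrA. Qed.
Let addC : commutative add.
Proof. by move=> u v; apply: dprodP => k; rewrite /add addrC. Qed.
Let add0 : left_id zero add.
Proof. by move=> u; apply: dprodP => k; rewrite /add add0r. Qed.
Let addN : left_inverse zero opp add.
Proof. by move=> u; apply: dprodP => k; rewrite /add addNr. Qed.
HB.instance Definition _ := GRing.isZmodule.Build dprod addA addC add0 addN.

Let scaleA a b u : scale a (scale b u) = scale (a * b) u.
Proof. by apply: dprodP => k; rewrite /scale scalerA. Qed.
Let scale1 : left_id 1 scale.
Proof. by move=> u; apply: dprodP => k; rewrite /scale scale1r. Qed.
Let scaleDr : right_distributive scale +%R.
Proof. by move=> a u v; apply: dprodP => k; rewrite /scale scalerDr. Qed.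
Let scaleDl u : {morph scale^~ u : a b / a + b}.
Proof. by move=> a b; apply: dprodP => k; rewrite /scale scalerDl. Qed.
HB.instance Definition _ :=
  GRing.Zmodule_isLmodule.Build R dprod scaleA scale1 scaleDr scaleDl.

Definition fin_support : {pred dprod} :=
  fun u => `[< exists n, forall k, (n <= k)%N -> u k = 0 >].

Lemma fin_support_closed : submod_closed fin_support.
Proof.
split; first by apply/asboolP; exists 0.
move=> a u v /asboolP[m um] /asboolP[n vn]; apply/asboolP.
exists (maxn m n) => k; rewrite geq_max => /andP[/um uk /vn vk].
by rewrite -[LHS]/(a *: u k + v k) uk vk scaler0 addr0.
Qed.
HB.instance Definition _ :=
  GRing.isSubmodClosed.Build R dprod fin_support fin_support_closed.

Definition dsum : lmodType R := subm fin_support.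

Definition dprod_in k (x : N k) : dprod :=
  @dfwith nat (fun j => N j) (fun=> 0) k x.

Lemma dsum_in_subproof k (x : N k) : dprod_in x \in fin_support.
Proof.
apply/asboolP; exists k.+1 => j kj; rewrite /dprod_in dfwith_out//.
by rewrite neq_ltn kj.
Qed.

Definition dsum_in k (x : N k) : dsum :=
  Sub (dprod_in x) (dsum_in_subproof x).

(* The usual presentation of the direct limit, which needs no functoriality of f:
   the direct sum modulo the submodule generated by all x - f x. *)
Definition dirlim (f : forall j k, (j <= k)%N -> {linear N j -> N k}) :
    lmodType R :=
  quotm (spanm [set u : dsum | exists j k (jk : (j <= k)%N) (x : N j),
                 u = dsum_in x - dsum_in (f j k jk x)]).

End DirectLimit.

Section LocalCohomology.
Variables (R : comNzRingType) (a : submodClosed R^o).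

Fixpoint ideal_pow (k : nat) : submodClosed R^o :=
  if k is j.+1 then
    spanm [set z : R^o | exists r s : R^o,
            [/\ r \in a, s \in ideal_pow j & z = r * s]]
  else spanm [set: R^o].

Lemma ideal_pow_le j k : (j <= k)%N -> {subset ideal_pow k <= ideal_pow j}.
Proof.
elim: k => [|k IHk]; first by rewrite leqn0 => /eqP->.
rewrite leq_eqVlt => /predU1P[->//|/IHk{}IHk] x /asboolP[s [sG ->]].
apply: IHk; rewrite big_seq; apply: rpred_sum => c /sG[r [t [_ tk ->]]].
by rewrite rpredZ// -[r * t]/(r *: (t : R^o)) rpredZ.
Qed.

Definition ideal_powM (M : lmodType R) (k : nat) : submodClosed M :=
  spanm [set y : M | exists r x, r \in ideal_pow k /\ y = r *: x].

Lemma ideal_powM_le (M : lmodType R) j k : (j <= k)%N ->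
  forall x, x \in ideal_powM M k -> idfun x \in ideal_powM M j.
Proof.
move=> jk x /asboolP[s [sG ->]]; apply/asboolP; exists s; split=> // c /sG.
by move=> [r [y [rk ->]]]; exists r, y; split=> //; apply: ideal_pow_le rk.
Qed.

Definition pow_proj (M : lmodType R) j k (jk : (j <= k)%N) :
  {linear quotm (ideal_powM M k) -> quotm (ideal_powM M j)} :=
  quotm_map (ideal_powM_le jk).

Definition gen_local_cohomology (i : nat) (M X : lmodType R) : lmodType R :=
  dirlim (N := fun k => Ext i (quotm (ideal_powM M k)) X)
    (fun j k jk => Ext_map i X (pow_proj M jk)).

Definition local_cohomology (i : nat) (X : lmodType R) : lmodType R :=
  gen_local_cohomology i R^o X.

(* The supremum in {-oo} U Z U {+oo} of all i with H^i_a(X) != 0: their largest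
   element if there is one, and -oo if all these modules vanish. *)
Definition cohomological_dimension (X : lmodType R) : \bar int :=
  supremum -oo%E [set i%:Z%:E | i in
    [set i : nat | exists x : local_cohomology i X, x <> 0]].

End LocalCohomology.

(* The universe of prime_idealr R is too large to form
   set (prime_idealr R). *)
Definition Spec (R : comNzRingType) :=
  {p : R -> bool | idealr_closed p /\ prime_idealr_closed p}.

Section Support.
Variables (R : comNzRingType) (p : Spec R) (N : lmodType R).

Lemma notin_prime1 : 1 \notin sval p.
Proof. by case: (svalP p) => -[]. Qed.

Lemma notin_primeM u v :
  u \notin sval p -> v \notin sval p -> u * v \notin sval p.
Proof.
case: (svalP p) => _ pM up vp; apply/negP => /pM.
by rewrite (negbTE up) (negbTE vp).
Qed.

(* The localization of N at p, as a set of fractions x / s with s not in p. *)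
Definition fraction := (N * {s : R | s \notin sval p})%type.

Definition fraction_eq (x y : fraction) : bool :=
  `[< exists2 u, u \notin sval p & u *: (val y.2 *: x.1) = u *: (val x.2 *: y.1) >].

Lemma fraction_eq_equiv : equiv_class_of fraction_eq.
Proof.
split=> [x|x y|y x z].
- by apply/asboolP; exists 1; rewrite ?notin_prime1.
- by apply/asboolP/asboolP => -[u up e]; exists u.
move=> /asboolP[u up e] /asboolP[v vp e']; apply/asboolP.
exists (u * v * val y.2).
  by rewrite !notin_primeM// (valP y.2).
rewrite !scalerA in e e' *.
have -> : u * v * val y.2 * val z.2 = v * val z.2 * (u * val y.2) by ring.
rewrite -[LHS]scalerA e scalerA.
have -> : v * val z.2 * (u * val x.2) = u * val x.2 * (v * val z.2) by ring.
rewrite -[LHS]scalerA e' scalerA.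
by congr (_ *: _); ring.
Qed.
Canonical fraction_equivRel := EquivRelPack fraction_eq_equiv.

Definition localization := {eq_quot fraction_eq}.

Definition localization_zero : localization :=
  \pi_localization (0, exist _ 1 notin_prime1).

End Support.

Definition Supp (R : comNzRingType) (N : lmodType R) : set (Spec R) :=
  [set p | exists z : localization p N, z <> localization_zero p N].

(* Main.v *)
Require Import Defs.
From HB Require Import structures.
From mathcomp Require Import all_boot all_order all_algebra.
From mathcomp Require Import boolp classical_sets functions constructive_ereal.
From mathcomp Require Import freeg generic_quotient.
Set Implicit Arguments.
Unset Strict Implicit.
Unset Printing Implicit Defensive.
Import Order.TTheory GRing.Theory.
Local Open Scope classical_set_scope.
Local Open Scope ring_scope.

(** Part (a) is what the spectral sequence
    Ext^p(M, H^q_a(X)) => H^(p+q)_a(M, X) says about supports.  Only the exact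
    couple that underlies it occurs below, unrolled one step at a time along a
    free resolution of M by modules of finite rank.

    Write T^n(M) for H^n_a(M, X).  On finitely generated modules T is a
    contravariant cohomological functor: for an exact sequence
    0 -> K -> P -> M -> 0, the elements of T^(n+1)(M) that vanish in T^(n+1)(P)
    come from T^n(K), and the elements of T^n(K) that come from T^n(P) give 0
    ([glc_connecting]).  This is the long exact sequence of Ext for the levels
    0 -> K / (K cap a^k P) -> P / a^k P -> M / a^k M -> 0, followed by the
    passage to the limit; the filtration of K induced by P may be replaced by
    the a-adic one because the two are cofinal, a weak form of the Artin-Rees
    lemma ([artin_rees]).

    A prime p is outside the support of N exactly when every element of N is
    killed by some s outside p ([killed_Supp]).  Take x in T^n(M) and a
    presentation 0 -> K -> P -> M -> 0 with P free of finite rank.  Pulling x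
    back along the maps R -> M, r |-> r m, gives a linear map M -> T^n(R), an
    element of Hom(M, H^n_a(X)); on P this correspondence is bijective.  If
    that element is killed by s, then s x vanishes on P and comes from some y in
    T^(n-1)(K).  Here y matters only modulo the image of T^(n-1)(P), and the
    linear map K -> T^(n-1)(R) attached to y matters only modulo the maps that
    extend to P, i.e. as an element of Ext^1(M, H^(n-1)_a(X)).  Killing it moves
    y to the next syzygy, where Ext^2(M, H^(n-2)_a(X)) takes over, and so on down
    to T^0, which is left exact ([killed_coker], [killed_of_Ext]).  This is (a).

    For (b) the same descent is used, with the simpler remark that T^i(P) is
    a finite direct sum of copies of H^i_a(X) ([killed_of_ring]).  The last
    inclusion follows from (b), because every i with H^i_a(X) nonzero is at most
    the cohomological dimension ([nat_ereal_supremums]).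

    The long exact sequence of Ext is obtained by comparing the free resolution
    of M with the mapping cone of the map between those of K and P, which is
    exact as well ([cone_exact]), by means of the comparison theorem
    ([chain_lift], [chain_homotopy]). *)

(** * Projective modules, complexes and chain homotopies *)

Section Linear.
Variable R : comNzRingType.
Implicit Types U V W P : lmodType R.

Definition mklin U V (f : U -> V) (fL : linear f) : {linear U -> V} :=
  HB.pack f (GRing.isLinear.Build R U V _ f fL).

Definition projective P := forall U V (g : {linear U -> V}) (f : {linear P -> V}),
  (forall x, exists u, g u = f x) ->
  exists h : {linear P -> U}, forall x, g (h x) = f x.

Lemma freemod_ext (K : choiceType) V (f g : {linear freemod R K -> V}) :
  (forall k, f << k >> = g << k >>) -> f =1 g.
Proof.
move=> fg x; rewrite -[x]freeg_sumE !raddf_sum; apply: eq_bigr => z _ /=.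
have -> : << coeff z x *g z >> = coeff z x *: (<< z >> : freemod R K).
  by apply/eqP/freeg_eqP => k; rewrite coeffZ !coeffU mul1r.
by rewrite !linearZ fg.
Qed.

Lemma freeliftE (K : choiceType) V (f : K -> V) k :
  freelift f (<< k >> : freemod R K) = f k.
Proof. by rewrite freeliftU scale1r. Qed.

Lemma freemod_projective (K : choiceType) : projective (freemod R K).
Proof.
move=> U V g f gf; pose u k := sval (cid (gf << k >>)).
exists (freelift u) => x.
apply: (freemod_ext (f := g \o freelift u) (g := f)) => k /=.
by rewrite freeliftE /u; case: cid.
Qed.

Lemma projective_prod P Q : projective P -> projective Q ->
  projective (P * Q)%type.
Proof.
move=> pP pQ U V g f gf.
have lL : linear (fun x : P => (x, 0) : (P * Q)%type).
  by move=> a x y; congr pair; rewrite /= scaler0 addr0.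
have rL : linear (fun x : Q => (0, x) : (P * Q)%type).
  by move=> a x y; congr pair; rewrite /= scaler0 addr0.
have [h1 h1E] := pP _ _ g (f \o mklin lL) (fun x => gf (x, 0)).
have [h2 h2E] := pQ _ _ g (f \o mklin rL) (fun x => gf (0, x)).
have hL : linear (fun x : P * Q => h1 x.1 + h2 x.2).
  by move=> a x y; rewrite !linearP scalerDr addrACA.
exists (mklin hL) => -[x y] /=; rewrite linearD h1E h2E /= -linearD.
by congr (f (_, _)); rewrite /= ?addr0 ?add0r.
Qed.

End Linear.

Section Complexes.
Variable R : comNzRingType.

(** Complexes are augmented: the module being resolved is put in position 0 and
    degree n sits in position n.+1.  A chain map over a given map of modules is
    then just a chain map with a prescribed component 0. *)
Record complex := Complex {
  obj :> nat -> lmodType R;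
  bd : forall n, {linear obj n.+1 -> obj n};
  bdK : forall n x, bd n (bd n.+1 x) = 0 }.
Arguments bd : clear implicits.

Definition exactc (C : complex) :=
  (forall x, exists y, bd C 0 y = x) /\
  (forall n x, bd C n x = 0 -> exists y, bd C n.+1 y = x).

Definition chain (C D : complex) (f : forall n, {linear C n -> D n}) :=
  forall n x, f n (bd C n x) = bd D n (f n.+1 x).

(** The invariant G carries what the next choice needs to know about the
    previous ones. *)
Lemma dependent_choice (T : nat -> Type) (G : forall n, T n -> Prop)
    (Q : forall n, T n -> T n.+1 -> Prop) x0 :
  G 0 x0 -> (forall n x, G n x -> exists2 y, Q n x y & G n.+1 y) ->
  exists f : forall n, T n, f 0 = x0 /\ forall n, Q n (f n) (f n.+1).
Proof.
move=> G0 step.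
pose next n (x : {x | G n x}) : {y | G n.+1 y} :=
  let c := cid2 (step n (sval x) (svalP x)) in exist _ (s2val c) (s2valP' c).
pose fix F n : {x | G n x} := if n is m.+1 then next m (F m) else exist _ x0 G0.
exists (fun n => sval (F n)); split=> // n.
exact: (s2valP (cid2 (step n (sval (F n)) (svalP (F n))))).
Qed.

(** The recursion is kept going by the invariant that the component already
    built sends boundaries to cycles, so that exactness of D allows to lift. *)
Lemma chain_lift (C D : complex) (f0 : {linear C 0 -> D 0}) :
  (forall n, projective (C n.+1)) -> exactc D ->
  exists2 f : forall n, {linear C n -> D n}, f 0 = f0 & chain f.
Proof.
move=> pC [D0 DS].
pose G n : {linear C n -> D n} -> Prop :=
  match n with
  | 0 => fun=> True
  | m.+1 => fun f => forall x, bd D m (f (bd C m.+1 x)) = 0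
  end.
have [||f [<- fE]] := @dependent_choice (fun n => {linear C n -> D n}) G
  (fun n f g => forall x, f (bd C n x) = bd D n (g x)) f0.
- by [].
- move=> n f Gf.
  have fD x : exists u, bd D n u = f (bd C n x).
    by case: n f Gf x => [|n] f Gf x; [exact: D0 | exact/DS/Gf].
  have [h hE] := pC n _ _ (bd D n) (f \o bd C n) fD.
  by exists h => x; rewrite ?hE//= bdK linear0.
by exists f.
Qed.

(** Two consecutive components h, k of the homotopy suffice to compare
    cocycles.  The last clause records that in position 0 the homotopy vanishes
    if h0 does, as it may for maps that agree there. *)
Lemma chain_homotopy (C D : complex) (f g : forall n, {linear C n -> D n})
    (h0 : {linear C 0 -> D 1}) :
  (forall n, projective (C n.+1)) -> exactc D -> chain f -> chain g ->
  (forall x, f 0 x = g 0 x + bd D 0 (h0 x)) ->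
  forall n, exists (h : {linear C n -> D n.+1}) (k : {linear C n.+1 -> D n.+2}),
    (forall x, f n.+1 x = g n.+1 x + bd D n.+1 (k x) + h (bd C n x)) /\
    ((forall x, h0 x = 0) -> n = 0 -> forall x, h x = 0).
Proof.
move=> pC [D0 DS] fC gC fg0.
have lift n (h : {linear C n -> D n.+1}) :
    (forall x, bd D n (f n.+1 x - g n.+1 x - h (bd C n x)) = 0) ->
    exists k : {linear C n.+1 -> D n.+2},
      forall x, f n.+1 x = g n.+1 x + bd D n.+1 (k x) + h (bd C n x).
  move=> e; have [k kE] := pC n _ _ (bd D n.+1)
    (f n.+1 \- g n.+1 \- (h \o bd C n)) (fun x => DS _ _ (e x)).
  exists k => x; rewrite kE /=.
  by rewrite -addrA subrK addrC subrK.
elim=> [|n [h [k [kE _]]]].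
  have [x|k kE] := lift 0 h0; last by exists h0, k.
  by rewrite !linearB /= -fC -gC fg0 -addrA -opprD subrr.
have [x|k' k'E] := lift n.+1 k; last by exists k, k'.
by rewrite !linearB /= -fC -gC kE bdK linear0 addr0 -addrA -opprD subrr.
Qed.

(** The clause about n = 0 accounts for the augmentation: in degree 0 there is
    no coboundary but 0, although maps through position 0 exist. *)
Definition cobounds (C : complex) (X : lmodType R) n (u : C n.+1 -> X) :=
  exists t : {linear C n -> X},
    (forall x, u x = t (bd C n x)) /\ (n = 0 -> forall x, t x = 0).

Definition cocycle (C : complex) (X : lmodType R) n (u : C n.+1 -> X) :=
  forall x, u (bd C n.+1 x) = 0.

Lemma cobounds_ext (C : complex) (X : lmodType R) n (u v : C n.+1 -> X) :
  u =1 v -> cobounds u -> cobounds v.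
Proof. by move=> /funext->. Qed.

Lemma cobounds0 (C : complex) (X : lmodType R) n : cobounds (fun _ : C n.+1 => 0 : X).
Proof. by exists (\0 : {linear _ -> _}); split=> // x; rewrite null_fun_eq. Qed.

Lemma cobounds_lin (C : complex) (X : lmodType R) n a (u v : C n.+1 -> X) :
  cobounds u -> cobounds v -> cobounds (fun x => a *: u x + v x).
Proof.
move=> [t [tE t0]] [s [sE s0]].
exists ((a \*: t) \+ s); split=> [x|n0 x] /=; first by rewrite tE sE.
by rewrite t0// s0// scaler0 addr0.
Qed.

Lemma cobounds_chain (C D : complex) (X : lmodType R) n (f : forall n, {linear C n -> D n})
    (u : D n.+1 -> X) :
  chain f -> cobounds u -> cobounds (u \o f n.+1).
Proof.
move=> fC [t [tE t0]]; exists (t \o f n); split=> [x|n0 x] /=.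
  by rewrite tE fC.
by rewrite t0.
Qed.

Lemma cobounds_homotopy (C D : complex) (X : lmodType R) n
    (f g : forall n, {linear C n -> D n}) (u : {linear D n.+1 -> X}) :
  (forall n, projective (C n.+1)) -> exactc D -> chain f -> chain g ->
  f 0 =1 g 0 -> cocycle u ->
  cobounds (fun x => u (f n.+1 x) - u (g n.+1 x)).
Proof.
move=> pC eD fC gC fg uZ.
have [x|h [k [kE h0]]] := chain_homotopy (h0 := \0) pC eD fC gC _ n.
  by rewrite linear0 addr0.
exists (u \o h); split=> [x|n0 x] /=.
  by rewrite kE !linearD /= uZ addr0 addrAC subrr add0r.
by rewrite h0// linear0.
Qed.

(** If position 0 is projective too, the identity is homotopic to 0. *)
Lemma cobounds_projective (C : complex) (X : lmodType R) n (u : {linear C n.+2 -> X}) :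
  (forall n, projective (C n)) -> exactc C -> cocycle u -> cobounds u.
Proof.
move=> pC eC uZ; have [s sE] := pC 0 _ _ (bd C 0) idfun eC.1.
have [||x|h [k [kE _]]] := chain_homotopy (f := fun n => idfun : {linear C n -> C n})
  (g := fun n => \0) (h0 := s) (fun n => pC n.+1) eC _ _ _ n.+1.
- by [].
- by move=> m x; rewrite linear0.
- by rewrite sE add0r.
exists (u \o h); split=> // x.
by rewrite -[x in LHS]/(idfun x) kE !linearD /= linear0 add0r uZ add0r.
Qed.

End Complexes.

Arguments bd {R} _ _.

(** * The mapping cone *)

Section Cone.
Variables (R : comNzRingType) (A B C : complex R).
Variables (j : forall n, {linear A n -> B n}) (q : forall n, {linear B n -> C n}).
Hypotheses (jC : chain j) (qC : chain q) (qj0 : forall n x, q n (j n x) = 0).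

(** The cone of j : A -> B resolves the cokernel C 0 of j 0: the copies of A 0
    and B 0 at its bottom are replaced by C 0. *)
Definition cone_obj n : lmodType R :=
  match n with 0 => C 0 | 1 => B 1 | m.+2 => (B m.+2 * A m.+1)%type end.

Lemma cone_bd1_linear : linear (fun x : B 2 * A 1 => bd B 1 x.1 + j 1 x.2).
Proof. by move=> c x y; rewrite !linearP /= scalerDr addrACA. Qed.

Lemma cone_bdS_linear n : linear (fun x : B n.+3 * A n.+2 =>
  (bd B n.+2 x.1 + j n.+2 x.2, - bd A n.+1 x.2) : (B n.+2 * A n.+1)%type).
Proof.
move=> c x y; congr pair; rewrite /= !linearP /= ?linearN //.
by rewrite scalerDr addrACA.

Qed.

Definition cone_bd n : {linear cone_obj n.+1 -> cone_obj n} :=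
  match n with
  | 0 => q 0 \o bd B 0
  | 1 => mklin cone_bd1_linear
  | m.+2 => mklin (@cone_bdS_linear m)
  end.

Lemma cone_bdK n x : cone_bd n (cone_bd n.+1 x) = 0.
Proof.
case: n x => [|[|n]] [x y] /=; rewrite linearD /= bdK add0r.
- by rewrite -jC qj0.
- by rewrite -jC linearN subrr.
- by rewrite -jC !linearN subrr bdK /= !oppr0.
Qed.

Definition cone : complex R := Complex cone_bdK.

Definition cone_proj n : {linear cone n -> C n} :=
  match n with 0 => idfun | 1 => q 1 | m.+2 => q m.+2 \o fst end.

Lemma cone_projC : chain cone_proj.
Proof.
case=> [|[|n]] x /=; rewrite ?qC// linearD qj0 addr0 //= qC //.
Qed.

Hypotheses (eA : exactc A) (eB : exactc B) (j_inj : injective (j 0)).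
Hypotheses (q_surj : forall x, exists y, q 0 y = x).
Hypothesis (q_ker : forall x, q 0 x = 0 -> exists y, j 0 y = x).

(** The short exact sequence in position 0 is used only at the bottom of the
    cone; above, a cycle (b, a) is corrected first in A and then in B. *)
Lemma cone_exact : exactc cone.
Proof.
split=> [x|n x] /=.
  by have [y <-] := q_surj x; have [z <-] := eB.1 y; exists z.
case: n x => [|n] x /= => [/q_ker[y]|].
  have [a <-] := eA.1 y; rewrite jC => e.
  have [|b bE] := eB.2 0 (x - j 1 a); first by rewrite linearB e subrr.
  by exists (b, a); rewrite /= bE subrK.
move=> x0.
have ax0 : bd A n x.2 = 0.
  case: n x x0 => [|n] x /= [e]; last by move/eqP; rewrite oppr_eq0 => /eqP.
  apply: j_inj; rewrite linear0 jC -[j 1 _](addKr (bd B 1 x.1)) e addr0.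
  by rewrite linearN /= bdK oppr0.
have bx0 : bd B n.+1 x.1 + j n.+1 x.2 = 0.
  by case: n x x0 {ax0} => [|n] x /= [].
have [a aE] := eA.2 _ _ ax0.
have [|b bE] := eB.2 n.+1 (x.1 + j n.+2 a).
  by rewrite linearD /= -jC aE.
exists (b, - a); rewrite /= bE !linearN addrK opprK aE.
by case: x {x0 ax0 bx0 aE bE}.
Qed.

Hypotheses (pC : forall n, projective (C n.+1)) (eC : exactc C).
Variable X : lmodType R.

(** Exactness of the long sequence at H^(n+1)(C): u is the class attached by
    the connecting map to v o j.  Pulled back to the cone, u is the coboundary of
    (v, t), with t a primitive of v o j; the cone and C compute the same
    cohomology. *)
Lemma cone_null n (u : {linear C n.+2 -> X}) (v : {linear B n.+1 -> X}) :
  cocycle u -> (forall x, u (q n.+2 x) = v (bd B n.+1 x)) ->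
  cobounds (v \o j n.+1) -> cobounds u.
Proof.
move=> uZ uv [t [tE t0]].
have {}tE x : v (j n.+1 x) = t (bd A n x) by exact: tE.
have [s s0 sC] := chain_lift (C := C) (D := cone) idfun pC cone_exact.
(* In degree 0 the cone contains B 1 only, and t is zero. *)
have uP : cobounds (u \o cone_proj n.+2).
  case: n u v {uZ} uv t tE t0 => [|n] u v uv t tE t0.
    by exists v; split=> //= -[x y] /=; rewrite linearD uv tE t0// addr0.
  have L : linear (fun x : B n.+2 * A n.+1 => v x.1 + t x.2).
    by move=> c x y; rewrite !linearP /= scalerDr addrACA.
  exists (mklin L); split=> //= -[x y] /=.
  by rewrite linearD uv linearN tE addrK.
have uPs := cobounds_chain sC uP.
have cC : chain (fun n => cone_proj n \o s n).
  by move=> m x /=; rewrite sC cone_projC.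
have iC : chain (fun n => idfun : {linear C n -> C n}) by [].
have [x|] := cobounds_homotopy (g := fun n => cone_proj n \o s n) pC eC iC cC _ uZ.
  by rewrite /= s0.
move=> t' t'P.
have := cobounds_lin 1 (ex_intro _ t' t'P) uPs; apply: cobounds_ext => x /=.
by rewrite scale1r subrK.
Qed.

(** The connecting map on H^n(A), and exactness at H^n(A): y defines a cocycle
    (b, a) |-> y a of the cone, which is transported to C.  When c y bounds on
    the cone by a primitive (v, t), its two components say that v is a cocycle
    of B and that c y - v o j bounds. *)
Lemma cone_connect n (y : {linear A n.+1 -> X}) :
  (forall n, projective (A n.+1)) -> (forall n, projective (B n.+1)) ->
  cocycle y -> exists2 u : {linear C n.+2 -> X}, cocycle u &
    forall c, cobounds (fun x => c *: u x) ->
    exists2 v : {linear B n.+1 -> X}, cocycle v &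
      cobounds (fun x => c *: y x - v (j n.+1 x)).
Proof.
move=> pA pB yZ.
have [s s0 sC] := chain_lift (C := C) (D := cone) idfun pC cone_exact.
pose Y : {linear cone n.+2 -> X} := y \o snd.
have YZ : cocycle Y by move=> x; rewrite /= linearN yZ oppr0.
exists (Y \o s n.+2) => [x|c]; first by rewrite -[LHS]/(Y (s n.+2 (bd C n.+2 x))) sC YZ.
move=> /(cobounds_chain cone_projC) uB.
have cC : chain (fun n => s n \o cone_proj n).
  by move=> m x; rewrite -[LHS]/(s m (cone_proj m (bd cone m x))) cone_projC sC.
have iC : chain (fun n => idfun : {linear cone n -> cone n}) by [].
have pcone m : projective (cone m.+1).
  by case: m => [|m]; [exact: pB | exact: (projective_prod (pB m.+1) (pA m))].
have [|t' t'P] := cobounds_homotopy (g := fun n => s n \o cone_proj n)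
  pcone cone_exact iC cC _ YZ.
  by rewrite /= s0.
have [t [tE _]] := cobounds_lin c (ex_intro _ t' t'P) uB.
have {}tE x : c *: y x.2 = t (cone_bd n.+1 x).
  by rewrite -tE /= scalerBr subrK.
have iL m : linear (fun x : B m.+2 => (x, 0) : (B m.+2 * A m.+1)%type).
  by move=> a b b'; congr pair; rewrite /= scaler0 addr0.
have rL m : linear (fun x : A m.+1 => (0, x) : (B m.+2 * A m.+1)%type).
  by move=> a b b'; congr pair; rewrite /= scaler0 addr0.
case: n y yZ {YZ uB t'P t'} Y t tE => [|n] y yZ Y t tE.
  exists t => [x|].
    by have := tE (x, 0); rewrite /= !linear0 addr0 ?scaler0 => <-.
  apply: cobounds_ext (cobounds0 _ _ _) => x.
  by have := tE (0, x); rewrite /= linear0 add0r => ->; rewrite subrr.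
exists (t \o mklin (iL n)) => [x|] /=.
  by have := tE (x, 0); rewrite /= !linear0 addr0 ?scaler0 ?oppr0 => <-.
exists (- 1 \*: (t \o mklin (rL n))); split=> // x.
have := tE (0, x); rewrite /= linear0 add0r => ->.
rewrite -linearB -[in RHS]linearZ /=; congr (t (_, _)); rewrite /= ?subrr ?scaler0//.
by rewrite subr0 scaleN1r.
Qed.

End Cone.

(** * Cohomology classes of cochains *)

Section Cochains.
Variable R : comNzRingType.

Lemma val_subm_lin (V : lmodType R) (S : submodClosed V) a (x y : subm S) :
  val (a *: x + y) = a *: val x + val y.
Proof. by []. Qed.

Lemma Hom_lin (U V : lmodType R) a (f g : Defs.Hom U V) x :
  val (a *: f + g) x = a *: val f x + val g x.
Proof. by []. Qed.

Lemma Hom0 (U V : lmodType R) x : val (0 : Defs.Hom U V) x = 0.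
Proof. by []. Qed.

Lemma Hom_linear (U V : lmodType R) (f : Defs.Hom U V) : linear (val f).
Proof. exact/asboolP/(valP f). Qed.

Lemma Hom_val0 (U V : lmodType R) (f : Defs.Hom U V) : val f 0 = 0.
Proof. exact: linear0 (mklin (Hom_linear f)). Qed.

Lemma Hom_build (U V : lmodType R) (f : {linear U -> V}) :
  exists h : Defs.Hom U V, val h = f.
Proof.
have fL : linearp f by apply/asboolP => a x y; rewrite linearP.
by exists (Sub (f : _ -> _) fL).
Qed.

Lemma Hom_eq (U V : lmodType R) (f g : Defs.Hom U V) : val f =1 val g -> f = g.
Proof. by move=> fg; apply/val_inj/funext. Qed.

Lemma pim_eq0 (V : lmodType R) (S : submodClosed V) x :
  pim S x = 0 <-> x \in S.
Proof. by rewrite -[0](linear0 (pim S)) pimE subr0. Qed.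

Variables (C : nat -> lmodType R) (d : forall i, {linear C i -> C i.+1}).

(** Working with this relation avoids the representatives chosen by the
    quotient. *)
Definition class_of n (z : cohomology d n) (x : C n) :=
  exists2 c : cocycles d n, pim _ c = z & val c = x.

Lemma class_of_cocycle n (z : cohomology d n) x : class_of z x -> d n x = 0.
Proof. by case=> c _ <-; apply/eqP/(valP c). Qed.

Lemma class_of_repr n (z : cohomology d n) : exists x, class_of z x.
Proof. by elim/pim_ind: z => c; exists (val c), c. Qed.

Lemma class_of_exists n x : d n x = 0 -> exists z : cohomology d n, class_of z x.
Proof.
move=> /eqP dx; pose c : cocycles d n := Sub x dx.
by exists (pim _ c), c.
Qed.

Lemma class_of_lin n (z z' : cohomology d n) x x' a :
  class_of z x -> class_of z' x' -> class_of (a *: z + z') (a *: x + x').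
Proof.
case=> c <- <- [c' <- <-]; exists (a *: c + c').
  exact: pim_is_linear.
exact: val_subm_lin.
Qed.

Lemma class_of_inj n (z z' : cohomology d n) x :
  class_of z x -> class_of z' x -> z = z'.
Proof. by case=> c <- <- [c' <- /val_inj->]. Qed.

Lemma class_of0 n x : (forall i y, d i.+1 (d i y) = 0) ->
  class_of (0 : cohomology d n) x <-> x \in coboundary d n.
Proof.
move=> dd; split=> [[c /pim_eq0 c0 <-]|]; first exact: c0.
move=> xB; have dx : x \in kerp (d n).
  rewrite unfold_in; case: n x xB => [|n] x; first by move=> /eqP->; rewrite linear0.
  by move=> /asboolP[y <-]; rewrite dd.
by exists (Sub x dx) => //; apply/pim_eq0; exact: xB.
Qed.

End Cochains.

Lemma class_of_map (R : comNzRingType) (C D : nat -> lmodType R)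
    (c : forall i, {linear C i -> C i.+1}) (d : forall i, {linear D i -> D i.+1})
    (phi : forall i, {linear C i -> D i})
    (phiE : forall i x, d i (phi i x) = phi i.+1 (c i x)) n z x :
  class_of (d := c) (n := n) z x ->
  class_of (cohomology_map phiE n z) (phi n x).
Proof.
case=> y <- <-; exists (cocycles_map phiE n y) => //.
exact (esym (quotm_map_pim (@cohomology_map_subproof _ _ _ _ _ _ phiE n) y)).
Qed.

(** * The functorial free resolution *)

Arguments cocycle {R C X} n u.
Arguments cobounds {R C X} n u.

Section Resolution.
Variable R : comNzRingType.
Implicit Types M N A B C D X : lmodType R.

Definition augres_obj M n : lmodType R := if n is m.+1 then res M m else M.

Definition augres_bd M n : {linear augres_obj M n.+1 -> augres_obj M n} :=
  if n is m.+1 then res_diff M m else augmentation M.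

Lemma augK M (x : M) : augmentation M << x >> = x.
Proof. by rewrite /= freeliftE. Qed.

Lemma aug_syz M n (x : syzygy M n.+1) : augmentation (syzygy M n) (val x) = 0.
Proof. exact/eqP/(valP x). Qed.

Lemma res_diffE M n x :
  res_diff M n x = val (augmentation (syzygy M n.+1) x).
Proof. by []. Qed.

Lemma res_diffK M n x : res_diff M n (res_diff M n.+1 x) = 0.
Proof. rewrite (res_diffE (res_diff M n.+1 x)) (res_diffE x).
by rewrite (aug_syz (augmentation (syzygy M n.+2) x)). Qed.

Lemma res_diff_surj M n (x : res M n) :
  augmentation (syzygy M n) x = 0 -> exists y, res_diff M n y = x.
Proof.
move=> x0; have ax : x \in kerp (augmentation (syzygy M n)).
  by rewrite unfold_in; apply/eqP.
by exists << (Sub x ax : syzygy M n.+1) >>; rewrite res_diffE augK.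
Qed.

Lemma augres_bdK M n x : augres_bd M n (augres_bd M n.+1 x) = 0.
Proof. by case: n x => [|n] x; [exact: (@aug_syz M 0) | exact: res_diffK]. Qed.

Definition augres M := Complex (@augres_bdK M).

Lemma augres_exact M : exactc (augres M).
Proof.
split=> [x|[|n] x x0]; first by exists << x >>; apply: augK.
  exact: (@res_diff_surj M 0).
by apply: res_diff_surj; apply: val_inj.
Qed.

Lemma augres_projective M n : projective (augres M n.+1).
Proof. exact: freemod_projective. Qed.

Definition augres_map M N (f : {linear M -> N}) n : {linear augres M n -> augres N n} :=
  if n is m.+1 then res_map f m else f.

Lemma augres_mapC M N (f : {linear M -> N}) : chain (augres_map f).
Proof.
by case=> [|n] x; [rewrite /= aug_freemap | exact/esym/res_diff_map].
Qed.

(** Strict functoriality, stated for commutative squares so that composites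
    and zero composites are both covered. *)
Lemma syz_map_square A B C D (f : {linear A -> B}) (g : {linear B -> D})
    (f' : {linear A -> C}) (g' : {linear C -> D}) n :
  (forall x, g (f x) = g' (f' x)) ->
  forall x, syz_map g n (syz_map f n x) = syz_map g' n (syz_map f' n x).
Proof.
move=> gf; elim: n => [//|n IHn] x; apply: val_inj => /=.
have := freemod_ext (f := freemap R (syz_map g n) \o freemap R (syz_map f n))
  (g := freemap R (syz_map g' n) \o freemap R (syz_map f' n)).
by apply=> k /=; rewrite !freeliftE IHn.
Qed.

Lemma res_map_square A B C D (f : {linear A -> B}) (g : {linear B -> D})
    (f' : {linear A -> C}) (g' : {linear C -> D}) n :
  (forall x, g (f x) = g' (f' x)) ->
  forall x, res_map g n (res_map f n x) = res_map g' n (res_map f' n x).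
Proof.
move=> gf; apply: (freemod_ext (f := res_map g n \o res_map f n)
  (g := res_map g' n \o res_map f' n)) => k /=.
by rewrite !freeliftE (syz_map_square gf).
Qed.

End Resolution.

(** * Ext and its long exact sequence *)

Section Ext.
Variables (R : comNzRingType) (X : lmodType R).
Implicit Types M N P A B C : lmodType R.

Definition represents n M (z : Ext n M X) (u : res M n -> X) :=
  exists2 h : Defs.Hom (res M n) X,
    class_of (d := Ext_diff M X) (n := n) z h & val h = u.

Lemma Ext_diffE M n (h : Defs.Hom (res M n) X) x :
  val (Ext_diff M X n h) x = val h (res_diff M n x).
Proof. by []. Qed.

Lemma Ext_diffK M n (h : Defs.Hom (res M n) X) :
  Ext_diff M X n.+1 (Ext_diff M X n h) = 0.
Proof.
apply: Hom_eq => x; rewrite !Ext_diffE res_diffK Hom_val0.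
exact/esym/Hom0.
Qed.

Lemma represents_linear n M (z : Ext n M X) u : represents z u -> linear u.
Proof. by case=> h _ <-; apply: Hom_linear. Qed.

Lemma represents_cocycle n M (z : Ext n M X) u : represents z u ->
  cocycle (C := augres M) n u.
Proof.
case=> h /class_of_cocycle hZ <- x.
by have := Ext_diffE h x; rewrite hZ Hom0 => <-.
Qed.

Lemma Ext_repr n M (z : Ext n M X) :
  exists2 u : {linear res M n -> X}, represents z u & cocycle (C := augres M) n u.
Proof.
have [h zh] := class_of_repr (z : cohomology (Ext_diff M X) n).
have zr : represents z (val h) by exists h.
by exists (mklin (represents_linear zr)) => //; apply: represents_cocycle zr.
Qed.

Lemma represents_exists n M (u : {linear res M n -> X}) :
  cocycle (C := augres M) n u -> exists z : Ext n M X, represents z u.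
Proof.
move=> uZ; have [h hu] := Hom_build u.
have hZ : Ext_diff M X n h = 0.
  by apply: Hom_eq => x; rewrite Ext_diffE hu Hom0; apply: uZ.
by have [z zh] := class_of_exists hZ; exists z, h.
Qed.

Lemma represents_lin n M (z z' : Ext n M X) u u' a :
  represents z u -> represents z' u' ->
  represents (a *: z + z') (fun x => a *: u x + u' x).
Proof.
case=> h zh <- [h' zh' <-]; exists (a *: h + h'); first exact: class_of_lin.
by apply/funext => x; exact: Hom_lin.
Qed.

Lemma represents_inj n M (z z' : Ext n M X) u :
  represents z u -> represents z' u -> z = z'.
Proof.
by case=> h zh <- [h' zh' /val_inj hh]; rewrite hh in zh'; apply: class_of_inj zh zh'.
Qed.

Lemma represents0 n M (u : res M n -> X) :
  represents (0 : Ext n M X) u <-> cobounds (C := augres M) n u.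
Proof.
split=> [[h /class_of0-/(_ (@Ext_diffK M)) h0 <-]|[t [tE t0]]].
  case: n u h h0 => [|n] u h /=.
    by move=> /eqP->; exists \0.
  move=> /asboolP[f <-]; exists (mklin (Hom_linear f)).
  by split=> // x; exact: Ext_diffE.
have uL : linear u by move=> a x y; rewrite !tE linearP linearP.
have [h hu] := Hom_build (mklin uL).
exists h => //; apply/class_of0; first exact: Ext_diffK.
case: n u t tE t0 uL h hu => [|n] u t tE t0 uL h hu.
  by apply/eqP/Hom_eq => x; rewrite hu /= tE t0.
have [f ft] := Hom_build t.
apply/asboolP; exists f; apply: Hom_eq => x.
by rewrite Ext_diffE ft hu /= tE.
Qed.

Lemma represents_scale n M (z : Ext n M X) u a :
  represents z u -> represents (a *: z) (fun x => a *: u x).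
Proof.
move=> zu; have := represents_lin a zu ((represents0 _).2 (cobounds0 (augres M) X n)).
by rewrite addr0; congr represents; apply/funext => x; rewrite addr0.
Qed.

Lemma represents_eq n M (z z' : Ext n M X) u u' :
  represents z u -> represents z' u' ->
  z = z' <-> cobounds (C := augres M) n (fun x => u x - u' x).
Proof.
move=> zu zu'; have := represents_lin (-1) zu' zu.
have -> : (fun x => -1 *: u' x + u x) = (fun x => u x - u' x).
  by apply/funext => x; rewrite scaleN1r addrC.
rewrite scaleN1r addrC => zuu; split=> [e|uu].
  by apply/represents0; rewrite e subrr in zuu.
apply: (subr0_eq (represents_inj zuu _)).
exact/represents0.
Qed.

Lemma represents_map n M N (f : {linear M -> N}) (z : Ext n N X) u :
  represents z u -> represents (Ext_map n X f z) (u \o res_map f n).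
Proof.
case=> h zh <-; exists (precomp (res_map f n) h) => //.
exact: (class_of_map (Ext_map_subproof f)).
Qed.

Lemma represents_homotopy n M N (z : Ext n M X) (u : {linear res N n -> X})
    (f g : forall m, {linear augres M m -> augres N m}) :
  chain f -> chain g -> f 0 =1 g 0 -> cocycle (C := augres N) n u ->
  represents z (u \o f n.+1) -> represents z (u \o g n.+1).
Proof.
move=> fC gC fg uZ zf.
have ugL : linear (u \o g n.+1) by move=> a x y; rewrite /= !linearP.
have ugZ : cocycle (C := augres M) n (mklin ugL).
  by move=> x; rewrite -[LHS]/(u (g n.+1 (bd (augres M) n.+1 x))) gC uZ.
have [z' z'g] := represents_exists ugZ.
suff -> : z = z' by [].
apply/(represents_eq zf z'g).
exact: cobounds_homotopy (@augres_projective _ M) (augres_exact N) fC gC fg uZ.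
Qed.

(** The free module on the underlying set of a module is not an additive
    functor; additivity of Ext holds because a chain map is determined up to
    homotopy by the map that it covers. *)
Lemma Ext_map_lin n M N (f g h : {linear M -> N}) a (z : Ext n N X) :
  (forall x, h x = a *: f x + g x) ->
  Ext_map n X h z = a *: Ext_map n X f z + Ext_map n X g z.
Proof.
move=> hE; have [u zu uZ] := Ext_repr z.
pose k m : {linear augres M m -> augres N m} := (a \*: augres_map f m) \+ augres_map g m.
have kC : chain k by move=> m x; rewrite /= !augres_mapC linearP.
have zk := represents_lin a (represents_map f zu) (represents_map g zu).
have zh := represents_homotopy (@augres_mapC _ _ _ h) kC hE uZ (represents_map h zu).
apply: represents_inj zh _; congr represents: zk; apply/funext => x /=.
by rewrite linearP.
Qed.

Lemma scaleN1_add (V : lmodType R) (x : V) : -1 *: x + x = 0.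
Proof. by rewrite scaleN1r addNr. Qed.

Lemma Ext_map0 n M N (f : {linear M -> N}) (z : Ext n N X) :
  (forall x, f x = 0) -> Ext_map n X f z = 0.
Proof.
move=> f0; rewrite -[RHS](scaleN1_add (Ext_map n X f z)); apply: Ext_map_lin => x.
by rewrite scaleN1_add f0.
Qed.

Lemma Ext_map_comp n M N P (f : {linear M -> N}) (g : {linear N -> P})
    (h : {linear M -> P}) (z : Ext n P X) :
  (forall x, h x = g (f x)) -> Ext_map n X h z = Ext_map n X f (Ext_map n X g z).
Proof.
move=> hE; have [u zu uZ] := Ext_repr z.
pose k m : {linear augres M m -> augres P m} := augres_map g m \o augres_map f m.
have kC : chain k by move=> m x; rewrite /= !augres_mapC.
have zh := represents_homotopy (@augres_mapC _ _ _ h) kC hE uZ (represents_map h zu).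
exact: represents_inj zh (represents_map f (represents_map g zu)).
Qed.

Lemma Ext_map_id n M (f : {linear M -> M}) (z : Ext n M X) :
  (forall x, f x = x) -> Ext_map n X f z = z.
Proof.
move=> fE; have [u zu uZ] := Ext_repr z.
have iC : chain (fun m => idfun : {linear augres M m -> augres M m}) by [].
have zf := represents_homotopy (@augres_mapC _ _ _ f) iC fE uZ (represents_map f zu).
exact: represents_inj zf zu.
Qed.

Lemma Ext_projective n M (z : Ext n.+1 M X) : projective M -> z = 0.
Proof.
move=> pM; have [u zu uZ] := Ext_repr z.
apply: represents_inj zu _; apply/represents0.
apply: cobounds_projective (augres_exact M) uZ; case=> [|m] //.
exact: augres_projective.
Qed.

Lemma Ext0_of_hom M (h : {linear M -> X}) :
  exists z : Ext 0 M X, represents z (h \o augmentation M).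
Proof.
apply: represents_exists => x /=.
by have := augres_bdK (n := 0) x; rewrite /= => ->; rewrite linear0.
Qed.

(** A cocycle of degree 0 takes the same value on elements with the same
    augmentation. *)
Lemma Ext0_to_hom M (z : Ext 0 M X) :
  exists h : {linear M -> X}, represents z (h \o augmentation M).
Proof.
have [u zu uZ] := Ext_repr z.
have u_aug x y : augmentation M x = augmentation M y -> u x = u y.
  move=> xy; apply/subr0_eq; rewrite -linearB.
  have [|t <-] := @res_diff_surj _ M 0 (x - y); last exact: uZ.
  by rewrite linearB; apply/eqP; rewrite subr_eq0; apply/eqP.
have hL : linear (fun x : M => u << x >>).
  move=> b x y; rewrite -linearP; apply: u_aug.
  by rewrite linearP !augK.
exists (mklin hL); congr represents: zu; apply/funext => x.
by apply: u_aug; rewrite augK.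
Qed.

Lemma Ext0_inj B C (q : {linear B -> C}) (z : Ext 0 C X) :
  (forall x, exists y, q y = x) -> Ext_map 0 X q z = 0 -> z = 0.
Proof.
move=> q_surj qz0; have [u zu uZ] := Ext_repr z.
have := represents_map q zu; rewrite qz0 => /represents0[t [uE t0]].
apply: represents_inj zu _; apply/represents0; apply: cobounds_ext (cobounds0 _ _ _).
apply: (freemod_ext (f := \0) (g := u)) => k; have [b <-] := q_surj k.
by have := uE << b >>; rewrite (t0 erefl) /= freeliftE => ->.
Qed.

Section LongExact.
Variables (A B C : lmodType R) (i : {linear A -> B}) (q : {linear B -> C}).

Definition short_exact := [/\ injective i, forall x, exists y, q y = x,
  forall x, q (i x) = 0 & forall x, q x = 0 -> exists y, i y = x].

(** The map induced by i is not killed by the one induced by q: the composite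
    is the map induced by 0, which sends the generator of a to that of 0.
    Subtracting the map induced by 0 repairs this without changing the map
    covered. *)
Definition res_incl n : {linear augres A n -> augres B n} :=
  augres_map i n \- augres_map \0 n.

(** The graph of the connecting map.  As a relation, its naturality and the
    fact that it reaches all classes vanishing on B are immediate from the
    definition. *)
Definition connects n (y : Ext n A X) (z : Ext n.+1 C X) :=
  exists u : {linear res C n.+1 -> X}, exists v : {linear res B n -> X},
  [/\ represents z u, represents y (v \o res_incl n.+1) &
      forall x, u (res_map q n.+1 x) = v (res_diff B n x)].

Hypothesis iqS : short_exact.

Lemma res_inclC : chain res_incl.
Proof. by move=> m x; rewrite /= !augres_mapC linearB. Qed.

Lemma res_incl0 n x : augres_map q n (res_incl n x) = 0.
Proof.
case: iqS => _ _ qi _; rewrite /= linearB /=; apply/eqP; rewrite subr_eq0; apply/eqP.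
case: n x => [|n] x; first by rewrite /= qi linear0.
apply: (res_map_square (f := i) (f' := \0)) => {}x.
by rewrite qi /= linear0.
Qed.

Lemma connects_exists n (z : Ext n.+1 C X) :
  Ext_map n.+1 X q z = 0 -> exists y, connects (n := n) y z.
Proof.
have [u zu uZ] := Ext_repr z => qz0.
have := represents_map q zu; rewrite qz0 => /represents0[t [tE _]].
have vZ : cocycle (C := augres A) n (t \o res_incl n.+1).
  move=> x; rewrite -[LHS]/(t (res_incl n.+1 (bd (augres A) n.+1 x))) res_inclC.
  by rewrite -tE -[LHS]/(u (augres_map q n.+2 (res_incl n.+2 x))) res_incl0 linear0.
by have [y yP] := represents_exists vZ; exists y, u, t.
Qed.

Lemma connects_scale n (y : Ext n A X) (z : Ext n.+1 C X) a :
  connects y z -> connects (a *: y) (a *: z).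
Proof.
move=> [u [v [zu yv uv]]]; exists (a \*: u), (a \*: v); split.
- exact: represents_scale.
- exact: represents_scale yv.
- by move=> x /=; rewrite uv.
Qed.

Lemma represents_incl n (w : Ext n B X) (u : {linear res B n -> X}) :
  represents w u -> represents (Ext_map n X i w) (u \o res_incl n.+1).
Proof.
move=> wu; have := represents_lin (-1) (represents_map (\0 : {linear A -> B}) wu)
  (represents_map i wu).
rewrite [Ext_map n X \0 w]Ext_map0// scaler0 add0r.
congr represents; apply/funext => x.
by rewrite /= linearB scaleN1r addrC.
Qed.

Lemma connects_restriction n (w : Ext n B X) (z : Ext n.+1 C X) :
  connects (Ext_map n X i w) z -> z = 0.
Proof.
move=> [u [v [zu yv uv]]]; have [v' wv' v'Z] := Ext_repr w.
have uZ : cocycle (C := augres C) n.+1 u := represents_cocycle zu.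
apply: represents_inj zu _; apply/represents0.
case: iqS => i_inj q_surj qi q_ker.
have w0 := represents_incl wv'.
have uv' x : u (augres_map q n.+2 x) = (v \- v') (bd (augres B) n.+1 x).
  by rewrite /= -[v' _]/(v' (bd (augres B) n.+1 x)) v'Z subr0; apply: uv.
apply: (cone_null (v := v \- v') res_inclC (augres_mapC q) res_incl0
  (augres_exact A) (augres_exact B) _ _ _ (@augres_projective _ C) (augres_exact C) uZ uv').
- by move=> x y /=; rewrite !subr0 => /i_inj.
- exact: q_surj.
- by move=> x /q_ker[y <-]; exists y; rewrite /= subr0.
- by have /(represents_eq yv w0) := erefl (Ext_map n X i w).
Qed.

(** The kernel of the connecting map lies in the image of Ext^n(B, X).  Only
    the multiples of a single class y are considered, so that z may be any
    choice of its image. *)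
Lemma Ext_connecting n (y : Ext n A X) : exists z : Ext n.+1 C X,
  forall c, c *: z = 0 -> exists w, c *: y = Ext_map n X i w.
Proof.
have [v yv vZ] := Ext_repr y; case: iqS => i_inj q_surj qi q_ker.
have [|||u uZ uP] := cone_connect res_inclC (augres_mapC q) res_incl0
  (augres_exact A) (augres_exact B) _ _ _ (@augres_projective _ C)
  (@augres_projective _ A) (@augres_projective _ B) vZ.
- by move=> x x' /=; rewrite !subr0 => /i_inj.
- exact: q_surj.
- by move=> x /q_ker[x' <-]; exists x'; rewrite /= subr0.
have [z zu] := represents_exists uZ; exists z => c cz0.
have := represents_scale c zu; rewrite cz0 => zc.
have /uP[w wZ cw] := (represents0 _).1 zc.
have [w' w'P] := represents_exists wZ; exists w'.
have yc := represents_scale c yv.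
exact/(represents_eq yc (represents_incl w'P)).
Qed.

End LongExact.

Lemma connects_map n A B C A' B' C' (i : {linear A -> B}) (q : {linear B -> C})
    (i' : {linear A' -> B'}) (q' : {linear B' -> C'})
    (f : {linear A' -> A}) (g : {linear B' -> B}) (h : {linear C' -> C}) y z :
  (forall x, g (i' x) = i (f x)) -> (forall x, h (q' x) = q (g x)) ->
  connects i q (n := n) y z ->
  connects i' q' (Ext_map n X f y) (Ext_map n.+1 X h z).
Proof.
move=> gi hq [u [v [zu yv uv]]].
exists (u \o res_map h n.+1), (v \o res_map g n); split.
- exact: represents_map.
- have := represents_map f yv; congr represents; apply/funext => x /=.
  rewrite !linearB /=; congr (v _ - v _).
    by apply: res_map_square => {}x; rewrite gi.
  by apply: res_map_square => {}x; rewrite /= linear0.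
- move=> x; rewrite -[LHS]/(u (res_map h n.+1 (res_map q' n.+1 x))).
  rewrite (res_map_square hq) uv.
  by congr (v _); apply: res_diff_map.
Qed.

End Ext.

(** * Direct limits *)

Section DirectLimit.
Variables (R : comNzRingType) (N : nat -> lmodType R).
Variable f : forall j k, (j <= k)%N -> {linear N j -> N k}.
Hypothesis f_comp : forall j k l (jk : (j <= k)%N) (kl : (k <= l)%N) (jl : (j <= l)%N) x,
  f jl x = f kl (f jk x).

Lemma dsum_in_is_linear k : linear (@dsum_in R N k).
Proof.
move=> a x y; apply: val_inj; apply: functional_extensionality_dep => j.
rewrite -[RHS]/(a *: dprod_in x j + dprod_in y j) /= /dprod_in.
have [<-|kj] := eqVneq k j; first by rewrite !dfwith_in.
by rewrite !dfwith_out// scaler0 addr0.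
Qed.

HB.instance Definition _ k :=
  GRing.isLinear.Build R (N k) (dsum N) _ (@dsum_in R N k) (@dsum_in_is_linear k).

Definition cls k : {linear N k -> dirlim f} :=
  pim (spanm [set u : dsum N | exists j k (jk : (j <= k)%N) (x : N j),
    u = dsum_in x - dsum_in (f jk x)]) \o @dsum_in R N k.

Lemma cls_map k l (kl : (k <= l)%N) x : cls l (f kl x) = cls k x.
Proof.
apply/esym/pimE/asboolP; exists [:: (1, dsum_in x - dsum_in (f kl x))].
split; last by rewrite big_seq1 scale1r.
by move=> c; rewrite inE => /eqP->; exists k, l, kl, x.
Qed.

Lemma cls_surj z : exists k (x : N k), z = cls k x.
Proof.
elim/pim_ind: z => u; have /asboolP[n un] := valP u.
have uE : u = \sum_(k < n) dsum_in (val u k).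
  apply: val_inj; rewrite raddf_sum; apply: functional_extensionality_dep => j.
  have sumE (r : seq 'I_n) (F : 'I_n -> dprod N) :
      (\sum_(k <- r) F k) j = \sum_(k <- r) F k j.
    by elim: r => [|k r IHr]; rewrite ?big_nil// !big_cons -IHr.
  rewrite sumE /=; have [jn|nj] := ltnP j n.
    rewrite (bigD1 (Ordinal jn)) //= /dprod_in dfwith_in big1 ?addr0// => k kj.
    by rewrite dfwith_out.
  rewrite un// big1// => k _; rewrite /dprod_in dfwith_out//.
  by rewrite neq_ltn (leq_trans (ltn_ord k)).
exists n, (\sum_(k < n) f (ltnW (ltn_ord k)) (val u k)).
rewrite [in LHS]uE !linear_sum; apply: eq_bigr => k _.
exact/esym/cls_map.
Qed.

(** Moving all components with index at most l to level l detects vanishing: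
    it kills every relation between levels up to l. *)
Let retract l (u : dsum N) : N l := \sum_(j < l.+1) f (leq_ord j) (val u j).

Let retract_is_linear l : linear (retract l).
Proof.
move=> a u v; rewrite /retract scaler_sumr -big_split; apply: eq_bigr => j _.
exact: (linearP (f (leq_ord j)) a (val u j) (val v j)).
Qed.

Let retract_in k l (kl : (k <= l)%N) x : retract l (dsum_in x) = f kl x.
Proof.
rewrite /retract (bigD1 (Ordinal (kl : k < l.+1)%N)) //= /dprod_in dfwith_in.
rewrite big1 ?addr0 => [|j jk]; last by rewrite dfwith_out ?linear0// eq_sym.
by congr (f _ _); apply: bool_irrelevance.
Qed.

Lemma cls_eq0 k (x : N k) : cls k x = 0 ->
  exists l (kl : (k <= l)%N), f kl x = 0.
Proof.
move=> /pim_eq0/asboolP[s [sG xE]].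
(* n bounds the levels occurring in the finitely many relations used. *)
have [n nP] : exists n, forall c, c \in s -> forall l, (n <= l)%N ->
    mklin (@retract_is_linear l) c.2 = 0.
  elim: s sG {xE} => [|c s IHs] sG; first by exists 0.
  have [|n nP] := IHs; first by move=> d ds; apply: sG; rewrite inE ds orbT.
  have [j [j' [jj' [y cE]]]] := sG c (mem_head _ _).
  exists (maxn n j') => d; rewrite inE => /predU1P[->|ds] l.
    rewrite geq_max => /andP[_ j'l]; rewrite cE linearB /= .
    rewrite (retract_in (leq_trans jj' j'l)) (retract_in j'l).
    by rewrite -(f_comp jj' j'l (leq_trans jj' j'l)) subrr.
  by rewrite geq_max => /andP[nl _]; apply: nP.
exists (maxn n k), (leq_maxr n k); rewrite -(retract_in (leq_maxr n k)).
rewrite xE -[LHS]/(mklin (@retract_is_linear _) _) linear_sum big_seq big1// => c cs.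
by rewrite linearZ (nP c cs _ (leq_maxl n k)) /= scaler0.
Qed.

Lemma cls_eq k l (x : N k) (y : N l) : cls k x = cls l y ->
  exists m (km : (k <= m)%N) (lm : (l <= m)%N), f km x = f lm y.
Proof.
move=> e; have kn := leq_maxl k l; have ln := leq_maxr k l.
have [|m [nm]] := @cls_eq0 (maxn k l) (f kn x - f ln y).
  by rewrite linearB !cls_map e subrr.
rewrite linearB -(f_comp _ _ (leq_trans kn nm)) -(f_comp _ _ (leq_trans ln nm)).
move=> /subr0_eq e'; by exists m, (leq_trans kn nm), (leq_trans ln nm).
Qed.

End DirectLimit.

Section DirectLimitMap.
Variables (R : comNzRingType) (N N' : nat -> lmodType R).
Variable f : forall j k, (j <= k)%N -> {linear N j -> N k}.
Variable f' : forall j k, (j <= k)%N -> {linear N' j -> N' k}.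
Variable g : forall k, {linear N k -> N' k}.
Hypothesis gf : forall j k (jk : (j <= k)%N) x, g k (f jk x) = f' jk (g j x).

Definition dprod_map (u : dprod N) : dprod N' := fun k => g k (u k).

Lemma dprod_map_is_linear : linear dprod_map.
Proof.
move=> b u v; apply: functional_extensionality_dep => k.
exact: (linearP (g k) b (u k) (v k)).
Qed.
HB.instance Definition _ :=
  GRing.isLinear.Build R (dprod N) (dprod N') _ dprod_map dprod_map_is_linear.

Lemma dprod_map_fin u : u \in @fin_support R N -> dprod_map u \in @fin_support R N'.
Proof.
move=> /asboolP[n un]; apply/asboolP; exists n => k /un uk.
by rewrite /dprod_map uk linear0.
Qed.

Definition dsum_map : {linear dsum N -> dsum N'} := subm_map dprod_map_fin.

Lemma dsum_map_in k (x : N k) : dsum_map (dsum_in x) = dsum_in (g k x).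
Proof.
apply: val_inj; apply: functional_extensionality_dep => j /=.
rewrite /dprod_map /dprod_in; have [<-|kj] := eqVneq k j.
  by rewrite !dfwith_in.
by rewrite !dfwith_out// linear0.
Qed.

Definition dirlim_rel (N0 : nat -> lmodType R)
    (f0 : forall j k, (j <= k)%N -> {linear N0 j -> N0 k}) :=
  [set u : dsum N0 | exists j k (jk : (j <= k)%N) (x : N0 j),
     u = dsum_in x - dsum_in (f0 j k jk x)].

Lemma dsum_map_rel u : u \in spanm (dirlim_rel f) ->
  dsum_map u \in spanm (dirlim_rel f').
Proof.
move=> us; apply/asboolP; move: us => /asboolP[s [sG ->]].
exists [seq (c.1, dsum_map c.2) | c <- s]; split.
  move=> _ /mapP[c /sG[j [k [jk [x cE]]]] ->]; exists j, k, jk, (g j x).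
  by rewrite cE linearB !dsum_map_in gf.
rewrite big_map linear_sum; apply: eq_bigr => c _ /=.
exact: linearZ.
Qed.

Definition dirlim_map : {linear dirlim f -> dirlim f'} := quotm_map dsum_map_rel.

Lemma dirlim_map_cls k (x : N k) : dirlim_map (cls f k x) = cls f' k (g k x).
Proof.
rewrite -[RHS]/(pim _ (dsum_in (g k x))) -dsum_map_in.
exact (quotm_map_pim dsum_map_rel (dsum_in x)).
Qed.

End DirectLimitMap.

(** * Noetherian modules and the Artin-Rees property *)

Section Span.
Variables (R : comNzRingType) (V : lmodType R).
Implicit Types (G : set V) (S : submodClosed V).

Lemma spanm_ind G (P : V -> Prop) :
  P 0 -> (forall b x y, G x -> P y -> P (b *: x + y)) ->
  forall z, z \in spanm G -> P z.
Proof.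
move=> P0 PD z /asboolP[s [sG ->]].
elim: s sG => [|c s IHs] sG; first by rewrite big_nil.
rewrite big_cons; apply: PD; first by apply: sG; rewrite mem_head.
by apply: IHs => d ds; apply: sG; rewrite inE ds orbT.
Qed.

Lemma spanm_gen G x : G x -> x \in spanm G.
Proof.
move=> Gx; apply/asboolP; exists [:: (1, x)]; split; last by rewrite big_seq1 scale1r.
by move=> c; rewrite inE => /eqP->.
Qed.

Lemma spanm_min G S : (forall x, G x -> x \in S) -> {subset spanm G <= S}.
Proof.
move=> GS z; apply: (spanm_ind (P := fun z => z \in S)); first exact: rpred0.
by move=> b x y /GS xS yS; rewrite rpredD// rpredZ.
Qed.

Lemma submodB S x y : x \in S -> y \in S -> x - y \in S.
Proof. by move=> xS yS; rewrite -scaleN1r rpredD// rpredZ. Qed.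

Lemma spanm_cons (x : V) s z : z \in spanm [set` x :: s] ->
  exists b t, t \in spanm [set` s] /\ z = b *: x + t.
Proof.
apply: (spanm_ind (P := fun z => exists b t, t \in spanm [set` s] /\ z = b *: x + t)).
  by exists 0, 0; rewrite rpred0 scale0r addr0.
move=> b y w ys [c [t [ts ->]]]; move: ys; rewrite /= inE => /predU1P[->|ys].
  by exists (b + c), t; rewrite ts addrA scalerDl.
exists c, (b *: y + t); rewrite addrCA; split=> //.
by rewrite rpredD// rpredZ// spanm_gen.
Qed.

End Span.

Section Noetherian.
Variables (R : comNzRingType) (V : lmodType R).
Implicit Types (S : submodClosed V).

Lemma fin_gen_intro S (s : seq V) :
  {subset s <= S} -> {subset S <= spanm [set` s]} -> fin_gen S.
Proof.
move=> sS Ss; exists s => x; apply/idP/idP; first exact: Ss.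
exact: spanm_min.
Qed.

(** By induction on the generators of V, as in the basis theorem: the
    coefficients of x in the elements of S form an ideal I.  Lifts w b of its
    generators, with generators of the intersection of S with the span of the
    remaining ones, generate S. *)
Lemma noetherian_fin_gen S : noetherian R -> fin_gen_module V -> fin_gen S.
Proof.
move=> hR [s sV]; have {sV} : {subset S <= spanm [set` s]} by move=> x _; rewrite -sV.
elim: s S => [|x s IHs] S Ss.
  exact: (@fin_gen_intro S [::]).
pose S' := spanm [set y | y \in S /\ y \in spanm [set` s]].
have S'P y : y \in S' -> y \in S /\ y \in spanm [set` s].
  by move=> yS'; split; move: y yS'; apply: spanm_min => y [].
have [t tS'] := IHs S' (fun y yS' => (S'P y yS').2).
pose Q (b : R^o) y := y \in spanm [set` s] /\ b *: x + y \in S.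
have QP (b b' c : R^o) y y' : Q b y -> Q b' y' -> Q (c *: b + b') (c *: y + y').
  move=> [ys byS] [y's b'yS]; split; first by rewrite rpredD// rpredZ.
  have -> : (c *: b + b') *: x + (c *: y + y') = c *: (b *: x + y) + (b' *: x + y').
    by rewrite scalerDl scalerDr addrACA scalerA.
  by rewrite rpredD// rpredZ.
have Q0 : Q 0 0 by split; rewrite ?scale0r ?addr0 rpred0.
pose I := spanm [set b : R^o | exists y, Q b y].
have IP (b : R^o) : b \in I -> exists y, Q b y.
  apply: (@spanm_ind R R^o _ (fun b => exists y, Q b y)); first by exists 0.
  by move=> c b' b'' [y Qy] [y' Qy']; exists (c *: y + y'); apply: QP.
have [r rI] := hR I.
have /choice[w wP] : forall b : R^o, exists y, b \in r -> Q b y.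
  move=> b; have [br|_] := boolP (b \in r); last by exists 0.
  have [|y Qy] := IP b; last by exists y.
  by rewrite rI; apply: spanm_gen.
apply: (@fin_gen_intro S ([seq b *: x + w b | b <- r] ++ t)) => z.
  rewrite mem_cat => /orP[/mapP[b br ->]|zt]; first exact: (wP b br).2.
  by apply: (S'P z _).1; rewrite tS' spanm_gen.
move=> zS; have [b [y [ys zE]]] := spanm_cons (Ss z zS).
have bI : b \in I by apply: spanm_gen; exists y; split=> //; rewrite -zE.
pose T := [seq b *: x + w b | b <- r] ++ t.
pose Z (b : R^o) := exists u v, [/\ u \in spanm [set` T], u \in S,
  v \in spanm [set` s] & u = (b : R) *: x + v].
have [u [v [uT uS vs uE]]] : Z b.
  rewrite rI in bI; move: b bI {zE}; apply: (@spanm_ind R R^o _ Z).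
    by exists 0, 0; rewrite !rpred0 scale0r addr0.
  move=> c b b' br [u [v [uT uS vs uE]]].
  exists (c *: (b *: x + w b) + u), (c *: w b + v); have [wbs bwS] := wP b br.
  split; rewrite ?rpredD ?rpredZ//.
    by apply: spanm_gen; rewrite /= mem_cat; apply/orP; left; apply/mapP; exists b.
  by rewrite uE scalerDl scalerDr addrACA scalerA.
rewrite -(subrK u z) rpredD//.
have : z - u \in S'.
  apply: spanm_gen; split; first exact: submodB.
  by rewrite zE uE opprD addrACA subrr add0r; apply: submodB.
rewrite tS'; apply: spanm_min => y' y't; apply: spanm_gen.
by rewrite /= mem_cat y't orbT.
Qed.

(** Otherwise there is a strictly ascending sequence, but its union is finitely
    generated. *)
Lemma submodule_max (F : submodClosed V -> Prop) L0 :
  noetherian R -> fin_gen_module V -> F L0 ->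
  exists2 L : submodClosed V, F L &
    forall L' : submodClosed V, F L' -> {subset L <= L'} -> {subset L' <= L}.
Proof.
move=> hR hV FL0; apply: contrapT => noL.
have step L : F L -> exists2 L' : submodClosed V,
    {subset L <= L'} /\ ~ {subset L' <= L} & F L'.
  move=> FL; apply: contrapT => noL'; apply: noL; exists L => // L' FL' LL'.
  by apply: contrapT => L'L; apply: noL'; exists L'.
have [c [_ cS]] := @dependent_choice (fun=> submodClosed V) (fun=> F)
  (fun _ L L' => {subset L <= L'} /\ ~ {subset L' <= L}) L0 FL0 (fun _ L => @step L).
have cle j k : (j <= k)%N -> {subset c j <= c k}.
  elim: k => [|k IHk]; first by rewrite leqn0 => /eqP->.
  rewrite leq_eqVlt => /predU1P[->//|/IHk jk] x /jk.
  exact: (cS k).1.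
pose U := spanm [set x | exists k, x \in c k].
have UP x : x \in U -> exists k, x \in c k.
  apply: (spanm_ind (P := fun x => exists k, x \in c k)).
    by exists 0; rewrite rpred0.
  move=> b y z [k yk] [l zl]; exists (maxn k l).
  by rewrite rpredD ?rpredZ// ?(cle _ _ (leq_maxl _ _) _ yk)//
    (cle _ _ (leq_maxr _ _) _ zl).
have [s sU] := noetherian_fin_gen U hR hV.
have [n sn] : exists n, {subset s <= c n}.
  have : {subset s <= U} by move=> x xs; rewrite sU spanm_gen.
  elim: s {sU} => [|x s IHs] sU; first by exists 0.
  have [|n sn] := IHs; first by move=> y ys; apply: sU; rewrite inE ys orbT.
  have [m xm] := UP _ (sU x (mem_head _ _)).
  exists (maxn m n) => y; rewrite inE => /predU1P[->|/sn].
    exact: cle (leq_maxl _ _) _ xm.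
  exact: cle (leq_maxr _ _) _.
apply: (cS n).2 => x xn; have : x \in U by apply: spanm_gen; exists n.+1.
by rewrite sU; apply: spanm_min => y; apply: sn.
Qed.

End Noetherian.

Section IdealPower.
Variables (R : comNzRingType) (a : submodClosed R^o).

Lemma expr_ideal_pow x k m : x \in a -> (k <= m)%N -> x ^+ m \in ideal_pow a k.
Proof.
move=> xa km; apply: (ideal_pow_le km); elim: m {km} => [|m IHm].
  exact: spanm_gen.
by rewrite exprS; apply: spanm_gen; exists x, (x ^+ m).
Qed.

(** Long products of generators of a repeat one of them often. *)
Lemma ideal_pow_radical (I : R -> Prop) :
  fin_gen a -> I 0 -> (forall b x y, I x -> I y -> I (b * x + y)) ->
  (forall x, x \in a -> exists m, I (x ^+ m)) ->
  exists l, forall x, x \in ideal_pow a l -> I x.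
Proof.
move=> [s sa] I0 Ilin aI.
have IM b x : I x -> I (b * x) by move=> Ix; rewrite -[b * x]addr0; apply: Ilin.
have sI x : x \in s -> exists m, I (x ^+ m).
  by move=> xs; apply: aI; rewrite sa spanm_gen.
have [l lI] : exists l, forall t : seq R, {subset t <= s} -> (l <= size t)%N ->
      I (\prod_(x <- t) x).
  elim: (s) sI => [|x s' IHs] sI.
    by exists 1 => -[|y t] // ts; have := ts y (mem_head _ _).
  have [m xm] := sI x (mem_head _ _).
  have [|l lI] := IHs; first by move=> y ys; apply: sI; rewrite inE ys orbT.
  exists (m + l)%N => t ts tl.
  rewrite (bigID (pred1 x)) /= -big_filter -[X in _ * X]big_filter.
  have [mt|tm] := leqP m (count (pred1 x) t).
    rewrite mulrC; apply/IM.
    have /all_pred1P-> : all (pred1 x) (filter (pred1 x) t) by apply: filter_all.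
    rewrite big_nseq iter_mulr_1 size_filter -(subnK mt) exprD.
    exact: IM.
  apply/IM/lI => [y|].
    by rewrite mem_filter => /andP[/negbTE yx /ts]; rewrite inE yx.
  rewrite size_filter; have := count_predC (pred1 x) t.
  move=> e; rewrite -e in tl.
  by rewrite -(leq_add2l m); apply: leq_trans tl _; rewrite leq_add2r ltnW.
exists l => z zl; rewrite -[z]mulr1.
suff main c : (forall t : seq R, {subset t <= s} -> size t = l ->
    I ((\prod_(x <- t) x) * c)) -> I (z * c).
  by apply: main => t ts tl; rewrite mulr1; apply: lI ts _; rewrite tl.
elim: l z c zl {lI} => [|l IHl] z c zl lI.
  by apply/IM; have := lI [::] _ (erefl _); rewrite big_nil mul1r; apply.
move: z zl; apply: (@spanm_ind R R^o _ (fun z : R^o => I (z * c))).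
  by rewrite mul0r.
move=> b z y [r [w [ra wl ->]]] Iy; rewrite mulrDl -mulrA.
apply/Ilin/Iy; move: ra; rewrite sa => ra.
move: r ra; apply: (@spanm_ind R R^o _ (fun r : R^o => I (r * w * c))).
  by rewrite !mul0r.
move=> b' x y' xs Iy'; rewrite !mulrDl -!mulrA; apply/Ilin; last by rewrite mulrA.
rewrite mulrCA; apply: IHl => // t ts tl.
have := lI (x :: t); rewrite big_cons mulrCA mulrA; apply; last by rewrite /= tl.
by move=> y''; rewrite inE => /predU1P[->|/ts].
Qed.

(** By noetherianity, enlarge J to a submodule L maximal among those whose
    intersection with N is in J.  For x in a the chain of the preimages of L
    under x^m stabilizes, and then L + x^m V still meets N in J; so
    x^m V <= L by maximality.  As a is finitely generated, a^l V <= L for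
    some l. *)
Lemma artin_rees_sub (V : lmodType R) (N J : submodClosed V) k :
  noetherian R -> fin_gen_module V ->
  (forall r y, r \in ideal_pow a k -> y \in N -> r *: y \in J) ->
  exists l, forall y, y \in ideal_powM a V l -> y \in N -> y \in J.
Proof.
move=> hR hV kNJ.
pose F (L : submodClosed V) :=
  {subset J <= L} /\ forall y, y \in L -> y \in N -> y \in J.
have [L [JL LNJ] Lmax] :=
  @submodule_max R V F J hR hV (conj (fun x => id) (fun x xJ _ => xJ)).
pose I (x : R) := forall v, x *: v \in L.
have [||x xa|l lI] := @ideal_pow_radical I (hR a).
- by move=> v; rewrite scale0r rpred0.
- by move=> b x y Ix Iy v; rewrite scalerDl -scalerA rpredD// rpredZ.
- pose c m : submodClosed V := preimp (x ^+ m \*: idfun : {linear V -> V}) L.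
  have [S [m km SE] Smax] := @submodule_max R V
    (fun S => exists2 m, (k <= m)%N & S =i c m) (c k) hR hV
    (ex_intro2 _ _ k (leqnn k) (fun=> erefl)).
  have {}SE v : (v \in S) = (x ^+ m *: v \in L) by exact: SE.
  have stable v : x ^+ (m + m) *: v \in L -> x ^+ m *: v \in L.
    rewrite -SE; apply: (Smax (c (m + m)%N)).
      by exists (m + m)%N => //; apply: leq_trans km (leq_addr _ _).
    move=> w; rewrite SE => wm; rewrite -[_ \in _]/(x ^+ (m + m) *: w \in L).
    by rewrite exprD -scalerA rpredZ.
  exists m; pose L' := spanm [set y | exists z v, z \in L /\ y = z + x ^+ m *: v].
  have L'P y : y \in L' -> exists z v, z \in L /\ y = z + x ^+ m *: v.
    apply: (spanm_ind (P := fun y => exists z v, z \in L /\ y = z + x ^+ m *: v)).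
      by exists 0, 0; rewrite rpred0 scaler0 addr0.
    move=> b y1 y2 [z1 [v1 [z1L ->]]] [z2 [v2 [z2L ->]]].
    exists (b *: z1 + z2), (b *: v1 + v2); split; first by rewrite rpredD// rpredZ.
    by rewrite !scalerDr addrACA !scalerA mulrC.
  have LL' : {subset L <= L'}.
    by move=> y yL; apply: spanm_gen; exists y, 0; rewrite scaler0 addr0.
  suff FL' : F L'.
    move=> v; apply: (Lmax L' FL' LL'); apply: spanm_gen.
    by exists 0, v; rewrite rpred0 add0r.
  split=> [y /JL/LL'//|y /L'P[z [v [zL yE]]] yN].
  apply: LNJ (yN); rewrite yE rpredD//; apply: stable.
  have -> : x ^+ (m + m) *: v = x ^+ m *: y - x ^+ m *: z.
    by rewrite yE scalerDr addrAC subrr add0r scalerA exprD.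
  apply: submodB; last exact: rpredZ.
  exact: (JL _ (kNJ _ _ (expr_ideal_pow xa km) yN)).
exists l => y yl yN; apply: LNJ yN; move: y yl.
by apply: spanm_min => y [r [x [rl ->]]]; apply: lI.
Qed.

(** The a-adic filtration of K and the one induced by V are cofinal. *)
Lemma artin_rees (K V : lmodType R) (i : {linear K -> V}) k :
  noetherian R -> fin_gen_module V -> injective i ->
  exists l, forall y, i y \in ideal_powM a V l -> y \in ideal_powM a K k.
Proof.
move=> hR hV i_inj.
pose j : {linear subm (ideal_powM a K k) -> V} := i \o val.
have [|l lP] := @artin_rees_sub V (imp i) (imp j) k hR hV.
  move=> r _ rk /asboolP[y <-]; have ryk : r *: y \in ideal_powM a K k.
    by apply: spanm_gen; exists r, y.
  by apply/asboolP; exists (Sub (r *: y) ryk); rewrite /= linearZ.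
exists l => y yl; have /asboolP[z /i_inj <-] : i y \in imp j.
  by apply: lP yl _; apply/asboolP; exists y.
exact: valP.
Qed.

End IdealPower.

Section FreeModules.
Variable R : comNzRingType.

Lemma rV_lift_linear m (V : lmodType R) (w : 'I_m -> V) :
  linear (fun v : 'rV[R]_m => \sum_j v 0 j *: w j).
Proof.
move=> b u v; rewrite scaler_sumr -big_split; apply: eq_bigr => j _.
by rewrite !mxE scalerDl scalerA.
Qed.

Definition rV_lift m (V : lmodType R) (w : 'I_m -> V) := mklin (rV_lift_linear w).

Lemma rV_liftE m (V : lmodType R) (w : 'I_m -> V) j :
  rV_lift w (delta_mx 0 j) = w j.
Proof.
rewrite /= (bigD1 j)//= mxE !eqxx scale1r big1 ?addr0// => k kj.
by rewrite mxE (negbTE kj) andbF scale0r.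
Qed.

Lemma rV_ext m (V : lmodType R) (f g : {linear 'rV[R]_m -> V}) :
  (forall j, f (delta_mx 0 j) = g (delta_mx 0 j)) -> f =1 g.
Proof.
move=> fg v; rewrite [v]row_sum_delta !linear_sum; apply: eq_bigr => j _.
by rewrite !linearZ fg.
Qed.

Lemma rV_projective m : projective 'rV[R]_m.
Proof.
move=> U V g f gf; have /choice[w wP] : forall j, exists u, g u = f (delta_mx 0 j).
  by move=> j; apply: gf.
exists (rV_lift w) => x; apply: (rV_ext (f := g \o rV_lift w)) => j.
by rewrite -[LHS]/(g (rV_lift w _)) rV_liftE.
Qed.

Lemma fin_gen_rV m : fin_gen_module 'rV[R]_m.
Proof.
exists [seq (delta_mx 0 j : 'rV[R]_m) | j <- enum 'I_m] => v.
apply/idP/idP => // _; rewrite [v]row_sum_delta; apply: rpred_sum => j _.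
by rewrite rpredZ// spanm_gen//= map_f ?mem_enum.
Qed.

Lemma fin_gen_cover (V : lmodType R) : fin_gen_module V ->
  exists m (g : {linear 'rV[R]_m -> V}), forall x, exists y, g y = x.
Proof.
move=> [s sV]; exists (size s), (rV_lift (fun j => s`_j)) => x.
have : x \in spanm [set` s] by rewrite -sV.
apply: (spanm_ind (P := fun x => exists y, rV_lift _ y = x)).
  by exists 0; rewrite linear0.
move=> b z _ zs [y <-]; have js : (index z s < size s)%N by rewrite index_mem.
exists (b *: delta_mx 0 (Ordinal js) + y).
by rewrite linearP rV_liftE /= nth_index.
Qed.

Lemma fin_gen_subm (V : lmodType R) (S : submodClosed V) :
  fin_gen S -> fin_gen_module (subm S).
Proof.
move=> [s sS]; pose s' : seq (subm S) := [seq insubd 0 y | y <- s].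
exists s' => x; apply/idP/idP => // _.
suff main z : z \in spanm [set` s] -> forall x : subm S, val x = z ->
    x \in spanm [set` s'] by apply: (main (val x)) => //; rewrite -sS; apply: (valP x).
apply: (spanm_ind (P := fun z => forall x : subm S, val x = z -> x \in spanm [set` s'])).
  by move=> {}x x0; have -> : x = 0 by [apply: val_inj]; rewrite rpred0.
move=> b y w ys IHw {}x xE.
have yS : y \in S by rewrite sS spanm_gen.
rewrite -[x](subrK (b *: insubd 0 y)) addrC rpredD ?rpredZ//.
  by apply: spanm_gen; rewrite /= map_f.
by apply: IHw; rewrite /= xE insubdK// addrC addKr.
Qed.

End FreeModules.

(** * Generalized local cohomology as a cohomological functor *)

Section LocalCohomology.
Variables (R : comNzRingType) (a : submodClosed R^o) (X : lmodType R).
Implicit Types K M P U V W : lmodType R.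

Definition level M k := quotm (ideal_powM a M k).

Lemma ideal_powM_map U V (f : {linear U -> V}) k x :
  x \in ideal_powM a U k -> f x \in ideal_powM a V k.
Proof.
move: x; apply: (spanm_ind (P := fun x => f x \in ideal_powM a V k)).
  by rewrite linear0 rpred0.
move=> b _ y [r [x [rk ->]]] fy; rewrite linearP rpredD// rpredZ// linearZ.
by apply: spanm_gen; exists r, (f x).
Qed.

Definition level_map U V (f : {linear U -> V}) k :
  {linear level U k -> level V k} := quotm_map (@ideal_powM_map U V f k).

Lemma level_mapE U V (f : {linear U -> V}) k x :
  level_map f k (pim _ x) = pim _ (f x).
Proof. exact: quotm_map_pim. Qed.

Lemma pow_projE M j k (jk : (j <= k)%N) x :
  pow_proj a M jk (pim _ x) = pim _ x.
Proof. exact: (quotm_map_pim (ideal_powM_le jk)). Qed.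

Definition restrict n M j k (jk : (j <= k)%N) :
  {linear Ext n (level M j) X -> Ext n (level M k) X} :=
  Ext_map n X (pow_proj a M jk).

Arguments restrict {n M j k} jk.

Lemma restrictE n M j k (jk : (j <= k)%N) (x : Ext n (level M j) X) :
  restrict jk x = Ext_map n X (pow_proj a M jk) x.
Proof. by []. Qed.

Lemma restrict_comp n M j k l (jk : (j <= k)%N) (kl : (k <= l)%N) (jl : (j <= l)%N)
  (x : Ext n (level M j) X) : restrict jl x = restrict kl (restrict jk x).
Proof. by apply: Ext_map_comp; elim/pim_ind => y; rewrite (pow_projE kl) !pow_projE. Qed.

Lemma restrict_map n U V (f : {linear U -> V}) j k (jk : (j <= k)%N)
    (x : Ext n (level V j) X) :
  Ext_map n X (level_map f k) (restrict jk x) =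
  restrict jk (Ext_map n X (level_map f j) x).
Proof.
pose h : {linear level U k -> level V j} := pow_proj a V jk \o level_map f k.
have e1 : Ext_map n X h x = Ext_map n X (level_map f k) (Ext_map n X (pow_proj a V jk) x).
  exact: Ext_map_comp.
have e2 : Ext_map n X h x = Ext_map n X (pow_proj a U jk) (Ext_map n X (level_map f j) x).
  apply: Ext_map_comp; elim/pim_ind => y.
  by rewrite (pow_projE jk) level_mapE /= (level_mapE f k) (pow_projE jk).
exact: etrans (esym e1) e2.
Qed.

Definition glc n M := gen_local_cohomology a n M X.

Definition glc_cls n M k : {linear Ext n (level M k) X -> glc n M} :=
  cls (N := fun k => Ext n (level M k) X) (@restrict n M) k.

Lemma glc_cls_restrict n M j k (jk : (j <= k)%N) (x : Ext n (level M j) X) :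
  glc_cls n M k (restrict jk x) = glc_cls n M j x.
Proof. exact (cls_map (@restrict n M) jk x). Qed.

Lemma glc_cls_surj n M (z : glc n M) :
  exists k (x : Ext n (level M k) X), z = glc_cls n M k x.
Proof. exact (cls_surj (f := @restrict n M) z). Qed.

Lemma glc_cls_eq0 n M k (x : Ext n (level M k) X) : glc_cls n M k x = 0 ->
  exists l (kl : (k <= l)%N), restrict kl x = 0.
Proof. exact (cls_eq0 (@restrict_comp n M) (x := x)). Qed.

Definition glc_map n U V (f : {linear U -> V}) : {linear glc n V -> glc n U} :=
  dirlim_map (g := fun k => Ext_map n X (level_map f k)) (@restrict_map n U V f).

Lemma glc_map_cls n U V (f : {linear U -> V}) k (x : Ext n (level V k) X) :
  glc_map n f (glc_cls n V k x) = glc_cls n U k (Ext_map n X (level_map f k) x).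
Proof. exact: dirlim_map_cls. Qed.

Lemma glc_cls_eq n M k l (x : Ext n (level M k) X) (y : Ext n (level M l) X) :
  glc_cls n M k x = glc_cls n M l y ->
  exists m (km : (k <= m)%N) (lm : (l <= m)%N), restrict km x = restrict lm y.
Proof. exact (cls_eq (@restrict_comp n M) (x := x) (y := y)). Qed.

Lemma glc_map_eq0 n U V (f : {linear U -> V}) (z : glc n V) : glc_map n f z = 0 ->
  exists k (x : Ext n (level V k) X),
    z = glc_cls n V k x /\ Ext_map n X (level_map f k) x = 0.
Proof.
have [k [x ->]] := glc_cls_surj z.
move=> /(etrans (esym (glc_map_cls f x)))/glc_cls_eq0[l [kl fx0]].
exists l, (restrict kl x); split; first exact/esym/glc_cls_restrict.
exact: etrans (restrict_map f kl x) fx0.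
Qed.

Opaque glc_map glc_cls restrict level_map Ext_map pow_proj.

Lemma glc_map_lin n U V (f g h : {linear U -> V}) b (z : glc n V) :
  (forall x, h x = b *: f x + g x) -> glc_map n h z = b *: glc_map n f z + glc_map n g z.
Proof.
move=> hE; have [k [x ->]] := glc_cls_surj z.
rewrite (glc_map_cls h x) (glc_map_cls f x) (glc_map_cls g x).
have -> : Ext_map n X (level_map h k) x =
    b *: Ext_map n X (level_map f k) x + Ext_map n X (level_map g k) x.
  apply: Ext_map_lin; elim/pim_ind => y.
  rewrite (level_mapE f) (level_mapE g) (level_mapE h) hE.
  exact: pim_is_linear.
exact: linearP.
Qed.

Lemma glc_map_comp n U V W (f : {linear U -> V}) (g : {linear V -> W})
    (h : {linear U -> W}) (z : glc n W) :
  (forall x, h x = g (f x)) -> glc_map n h z = glc_map n f (glc_map n g z).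
Proof.
move=> hE; have [k [x ->]] := glc_cls_surj z.
have hx : Ext_map n X (level_map h k) x =
    Ext_map n X (level_map f k) (Ext_map n X (level_map g k) x).
  apply: Ext_map_comp; elim/pim_ind => y.
  by rewrite (level_mapE f) (level_mapE g) (level_mapE h) hE.
have fgx := etrans (congr1 (glc_map n f) (glc_map_cls g x))
  (glc_map_cls f (Ext_map n X (level_map g k) x)).
exact: etrans (glc_map_cls h x) (etrans (congr1 (glc_cls n U k) hx) (esym fgx)).
Qed.

Lemma glc_map_id n U (f : {linear U -> U}) (z : glc n U) :
  (forall x, f x = x) -> glc_map n f z = z.
Proof.
move=> fE; have [k [x ->]] := glc_cls_surj z; rewrite (glc_map_cls f x).
congr (glc_cls _ _ _ _); apply: Ext_map_id; elim/pim_ind => y.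
by rewrite level_mapE fE.
Qed.

Lemma glc_map0_inj M P (g : {linear P -> M}) (z : glc 0 M) :
  (forall x, exists y, g y = x) -> glc_map 0 g z = 0 -> z = 0.
Proof.
move=> g_surj /glc_map_eq0[k [x [-> gx0]]]; rewrite (Ext0_inj _ gx0) ?linear0//.
elim/pim_ind => y; have [y' <-] := g_surj y.
by exists (pim _ y'); rewrite level_mapE.
Qed.

Section Connecting.
Variables (K P M : lmodType R) (i : {linear K -> P}) (g : {linear P -> M}).
Hypothesis igS : short_exact i g.

(** The quotients of K by the filtration induced by P: with them, unlike with
    the a-adic levels of K, the sequences of levels are exact. *)
Definition induced_level k := quotm (preimp i (ideal_powM a P k)).

Definition induced_level_map k : {linear induced_level k -> level P k} :=
  quotm_map (f := i) (S := preimp i (ideal_powM a P k)) (T := ideal_powM a P k)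
    (fun x ix => ix).

Lemma induced_level_mapE k x : induced_level_map k (pim _ x) = pim _ (i x).
Proof. exact: quotm_map_pim. Qed.

Lemma induced_level_proj_subproof j k (jk : (j <= k)%N) x :
  x \in preimp i (ideal_powM a P k) -> idfun x \in preimp i (ideal_powM a P j).
Proof. exact: ideal_powM_le. Qed.

Definition induced_level_proj j k (jk : (j <= k)%N) :
    {linear induced_level k -> induced_level j} :=
  quotm_map (induced_level_proj_subproof jk).

Lemma induced_level_projE j k (jk : (j <= k)%N) x :
  induced_level_proj jk (pim _ x) = pim _ x.
Proof. exact: (quotm_map_pim (induced_level_proj_subproof jk)). Qed.

Lemma to_induced_subproof k x :
  x \in ideal_powM a K k -> idfun x \in preimp i (ideal_powM a P k).
Proof. exact: ideal_powM_map. Qed.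

Definition to_induced k : {linear level K k -> induced_level k} :=
  quotm_map (@to_induced_subproof k).

Lemma to_inducedE k x : to_induced k (pim _ x) = pim _ x.
Proof. exact: (quotm_map_pim (@to_induced_subproof k)). Qed.

Section OfInduced.
Variables (k l : nat).
Hypothesis kl : forall x, i x \in ideal_powM a P l -> x \in ideal_powM a K k.

Lemma of_induced_subproof x :
  x \in preimp i (ideal_powM a P l) -> idfun x \in ideal_powM a K k.
Proof. exact: kl. Qed.

Definition of_induced : {linear induced_level l -> level K k} :=
  quotm_map of_induced_subproof.

Lemma of_inducedE x : of_induced (pim _ x) = pim _ x.
Proof. exact: (quotm_map_pim of_induced_subproof). Qed.

End OfInduced.

Lemma ideal_powM_lift k x : x \in ideal_powM a M k ->
  exists2 y, y \in ideal_powM a P k & g y = x.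
Proof.
case: igS => _ g_surj _ _.
apply: (spanm_ind (P := fun x => exists2 y, y \in ideal_powM a P k & g y = x)).
  by exists 0; rewrite ?rpred0 ?linear0.
move=> b _ _ [r [x' [rk ->]]] [y yP <-]; have [z <-] := g_surj x'.
exists (b *: (r *: z) + y); last by rewrite linearP linearZ.
by rewrite rpredD// rpredZ// spanm_gen//; exists r, z.
Qed.

Lemma induced_level_ses k : short_exact (induced_level_map k) (level_map g k).
Proof.
case: igS => i_inj g_surj gi g_ker; split.
- elim/pim_ind => x; elim/pim_ind => y; rewrite !induced_level_mapE => /pimE.
  by rewrite -linearB => xy; apply/pimE.
- elim/pim_ind => x; have [y <-] := g_surj x.
  by exists (pim _ y); rewrite level_mapE.
- by elim/pim_ind => x; rewrite induced_level_mapE level_mapE gi linear0.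
- elim/pim_ind => x; rewrite level_mapE => /pim_eq0 /ideal_powM_lift[y yP gy].
  have [|z zE] := g_ker (x - y); first by rewrite linearB gy subrr.
  exists (pim _ z); rewrite induced_level_mapE zE; apply/pimE.
  by rewrite addrAC subrr add0r -scaleN1r rpredZ.
Qed.

Opaque induced_level_map induced_level_proj to_induced of_induced.

(** Elements are represented at a finite level k, where the long exact sequence
    of Ext provides y0 over K / (K cap a^k P).  An equation s y = i^* u holds at
    some a-adic level m of K; by cofinality it then holds over
    K / (K cap a^r P) for large r, where exactness gives s x = 0. *)
Lemma glc_connecting n (x : glc n.+1 M) : noetherian R -> fin_gen_module P ->
  glc_map n.+1 g x = 0 ->
  exists y : glc n K, forall s u, s *: y = glc_map n i u -> s *: x = 0.
Proof.
move=> hR hP /glc_map_eq0[k [x0 [-> gx0]]].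
have [y0 xy] := connects_exists (induced_level_ses k) gx0.
pose y1 := Ext_map n X (to_induced k) y0.
exists (glc_cls n K k y1) => s u.
have [l [u0 ->]] := glc_cls_surj u.
move=> sy; have [m [km [lm e]]] :=
  glc_cls_eq (etrans (linearZZ (glc_cls n K k) s y1) (etrans sy (glc_map_cls i u0))).
have [m' m'P] := artin_rees a m hR hP (let: And4 ii _ _ _ := igS in ii).
pose r := maxn m m'; have mr : (m <= r)%N := leq_maxl m m'.
have rP z : i z \in ideal_powM a P r -> z \in ideal_powM a K m.
  by move=> zr; apply/m'P/(ideal_powM_le (leq_maxr m m') zr).
have kr := leq_trans km mr.
have c : connects (induced_level_map r) (level_map g r)
    (Ext_map n X (induced_level_proj kr) (s *: y0)) (restrict kr (s *: x0)).
  rewrite restrictE; apply: (connects_map (g := pow_proj a P kr)) (connects_scale s xy).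
    elim/pim_ind => z; rewrite induced_level_projE (induced_level_mapE r).
    by rewrite !induced_level_mapE pow_projE.
  by elim/pim_ind => z; rewrite (level_mapE g r) !pow_projE level_mapE.
have e1 : Ext_map n X (induced_level_proj kr) (s *: y0) =
    Ext_map n X (of_induced rP) (restrict km (s *: y1)).
  rewrite restrictE /y1 -linearZZ.
  pose h : {linear level K m -> induced_level k} := to_induced k \o pow_proj a K km.
  have <- : Ext_map n X h (s *: y0) =
      Ext_map n X (pow_proj a K km) (Ext_map n X (to_induced k) (s *: y0)).
    exact: Ext_map_comp.
  apply: Ext_map_comp; elim/pim_ind => z.
  by rewrite induced_level_projE (of_inducedE rP) /= (pow_projE km) to_inducedE.
pose h : {linear induced_level r -> level P m} := level_map i m \o of_induced rP.
have e2 : Ext_map n X h (restrict lm u0) =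
    Ext_map n X (of_induced rP) (restrict lm (Ext_map n X (level_map i l) u0)).
  apply: etrans (congr1 (Ext_map n X (of_induced rP)) (restrict_map i lm u0)).
  exact: Ext_map_comp.
have e3 : Ext_map n X h (restrict lm u0) =
    Ext_map n X (induced_level_map r) (Ext_map n X (pow_proj a P mr) (restrict lm u0)).
  apply: Ext_map_comp; elim/pim_ind => z.
  by rewrite (induced_level_mapE r) pow_projE /= (of_inducedE rP) level_mapE.
rewrite e1 e -e2 e3 in c; have := connects_restriction (induced_level_ses r) c.
move=> /(congr1 (glc_cls n.+1 M r)); rewrite (glc_cls_restrict kr) linear0 => <-.
exact/esym/linearZZ.
Qed.

End Connecting.

End LocalCohomology.

(** * Supports and the descent along a free resolution *)

Section Killed.
Local Open Scope quotient_scope.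
Variables (R : comNzRingType) (p : Spec R).
Implicit Types M N K P : lmodType R.

Definition killed N := forall x : N, exists2 s, s \notin sval p & s *: x = 0.

Lemma killed_Supp N : ~ Supp N p <-> killed N.
Proof.
split=> [pN x|kN [z zN]].
  pose y := \pi_(localization p N) (x, exist _ 1 (notin_prime1 p)).
  have e : y = localization_zero p N by apply: contrapT => y0; apply: pN; exists y.
  move/eqmodP/asboolP: e => [s sp /= e]; exists s => //.
  by rewrite !scale1r scaler0 in e.
apply: zN; rewrite -[z]reprK; case: (repr z) => x t.
apply/eqmodP/asboolP; have [s sp sx] := kN x; exists s => //=.
by rewrite scale1r sx !scaler0.
Qed.

Lemma killed_seq N (l : seq N) : killed N ->
  exists2 s, s \notin sval p & forall x, x \in l -> s *: x = 0.
Proof.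
move=> kN; elim: l => [|y l [s sp sl]]; first by exists 1; rewrite ?notin_prime1.
have [t tp ty] := kN y; exists (s * t); first exact: notin_primeM.
move=> x; rewrite inE => /predU1P[->|xl]; first by rewrite -scalerA ty scaler0.
by rewrite mulrC -scalerA sl ?scaler0.
Qed.

Lemma hom_killed M N (h : {linear M -> N}) : killed (Ext 0 M N) ->
  exists2 s, s \notin sval p & forall x, s *: h x = 0.
Proof.
move=> kE; have [z zh] := Ext0_of_hom h; have [s sp sz] := kE z.
exists s => // x; have := represents_scale s zh; rewrite sz => /represents0[t [tE t0]].
by have := tE << x >>; rewrite t0//= => <-; rewrite augK.
Qed.

(** Ext^1(M, N) contains the linear maps K -> N modulo those that extend to
    P. *)
Lemma hom_extends K P M N (i : {linear K -> P}) (g : {linear P -> M})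
    (h : {linear K -> N}) : short_exact i g -> killed (Ext 1 M N) ->
  exists s, s \notin sval p /\ exists w : {linear P -> N}, forall x, s *: h x = w (i x).
Proof.
move=> ig kE; have [z zh] := Ext0_of_hom h.
have [y zy] := Ext_connecting ig z; have [s sp sy] := kE y.
exists s; split=> //; have [w sw] := zy s sy; have [w' ww'] := Ext0_to_hom w.
exists w' => x.
have [t [tE t0]] := (represents_eq (represents_scale s zh) (represents_map i ww')).1 sw.
have := tE << x >>; rewrite t0//= => /subr0_eq.
by rewrite aug_freemap !augK.
Qed.

Lemma Ext_killed_shift n K P M N (i : {linear K -> P}) (g : {linear P -> M}) :
  short_exact i g -> projective P -> killed (Ext n.+2 M N) -> killed (Ext n.+1 K N).
Proof.
move=> ig pP kE y; have [z zy] := Ext_connecting ig y.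
have [s sp sz] := kE z; exists s => //; have [w ->] := zy s sz.
by rewrite (Ext_projective w pP) linear0.
Qed.

End Killed.

(** The descent is carried out for any contravariant cohomological functor T;
    the connecting map enters through T_connecting only, as the statement that x
    depends on y modulo the image of T n P. *)
Section Chase.
Variables (R : comNzRingType) (p : Spec R).
Implicit Types K M P U V W : lmodType R.

Variable T : nat -> lmodType R -> lmodType R.
Variable Tmap : forall n U V, {linear U -> V} -> {linear T n V -> T n U}.
Arguments Tmap n {U V} _.
Hypothesis Tmap_lin : forall n U V (f g h : {linear U -> V}) b (z : T n V),
  (forall x, h x = b *: f x + g x) -> Tmap n h z = b *: Tmap n f z + Tmap n g z.
Hypothesis Tmap_comp : forall n U V W (f : {linear U -> V}) (g : {linear V -> W})
    (h : {linear U -> W}) (z : T n W),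
  (forall x, h x = g (f x)) -> Tmap n h z = Tmap n f (Tmap n g z).
Hypothesis Tmap_id : forall n U (f : {linear U -> U}) (z : T n U),
  (forall x, f x = x) -> Tmap n f z = z.
Hypothesis Tmap0_inj : forall M P (g : {linear P -> M}) (z : T 0 M),
  (forall x, exists y, g y = x) -> Tmap 0 g z = 0 -> z = 0.
Hypothesis T_connecting : forall n K P M (i : {linear K -> P}) (g : {linear P -> M})
    (x : T n.+1 M), short_exact i g -> fin_gen_module P -> Tmap n.+1 g x = 0 ->
  exists y : T n K, forall s u, s *: y = Tmap n i u -> s *: x = 0.
Hypothesis hR : noetherian R.

Lemma Tmap_zero n U V (h : {linear U -> V}) (z : T n V) :
  (forall x, h x = 0) -> Tmap n h z = 0.
Proof.
move=> h0; rewrite (@Tmap_lin n U V h h h (-1)) ?scaleN1r ?addNr// => x.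
by rewrite scaleN1r addNr h0.
Qed.

Lemma Tmap_sum n U V m (f : 'I_m -> {linear U -> V}) (h : {linear U -> V})
    (z : T n V) :
  (forall x, h x = \sum_j f j x) -> Tmap n h z = \sum_j Tmap n (f j) z.
Proof.
elim: (index_enum 'I_m) h => [|j r IHr] h hE.
  by rewrite big_nil Tmap_zero// => x; rewrite hE big_nil.
have sL : linear (fun x => \sum_(j <- r) f j x).
  move=> b x y; rewrite scaler_sumr -big_split; apply: eq_bigr => k _.
  exact: linearP.
rewrite big_cons -(IHr (mklin sL))// -[Tmap n (f j) z]scale1r.
by apply: Tmap_lin => x; rewrite hE big_cons scale1r.
Qed.

Lemma scal_linear M (m : M) : linear (fun r : R^o => (r : R) *: m).
Proof. by move=> b r s; rewrite scalerDl scalerA. Qed.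

Definition scal M (m : M) := mklin (scal_linear m).

Lemma eval_linear n M (x : T n M) : linear (fun m => Tmap n (scal m) x).
Proof.
move=> b m m'; apply: Tmap_lin => r /=.
by rewrite scalerDr !scalerA mulrC.
Qed.

(** T n M -> Hom(M, T n R), an isomorphism for free modules of finite rank
    (eval_inj, eval_surj). *)
Definition eval n M (x : T n M) : {linear M -> T n R^o} := mklin (eval_linear x).

Lemma eval_map n M P (f : {linear P -> M}) (x : T n M) u :
  eval (Tmap n f x) u = eval x (f u).
Proof. by apply/esym/Tmap_comp => r /=; rewrite linearZ. Qed.

Lemma coord_linear m (j : 'I_m) : linear (fun v : 'rV[R]_m => v 0 j : R^o).
Proof. by move=> b u v; rewrite !mxE. Qed.

Definition coord m (j : 'I_m) : {linear 'rV[R]_m -> R^o} := mklin (coord_linear j).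

Lemma eval_inj n m (x : T n 'rV[R]_m) : (forall j, eval x (delta_mx 0 j) = 0) -> x = 0.
Proof.
move=> x0; rewrite -[x](Tmap_id (f := idfun))//.
rewrite (Tmap_sum (f := fun j => scal (delta_mx 0 j) \o coord j)); last first.
  by move=> v; rewrite [LHS]row_sum_delta.
apply: big1 => j _; rewrite (@Tmap_comp _ _ _ _ (coord j) (scal (delta_mx 0 j)))//.
by have := x0 j; rewrite /= => ->; rewrite linear0.
Qed.

Lemma eval_surj n m (w : {linear 'rV[R]_m -> T n R^o}) :
  exists u : T n 'rV[R]_m, forall v, eval u v = w v.
Proof.
exists (\sum_j Tmap n (coord j) (w (delta_mx 0 j))); apply: rV_ext => k /=.
rewrite linear_sum (bigD1 k)//= big1 ?addr0 => [|j jk].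
  rewrite -(@Tmap_comp _ _ _ _ _ _ idfun) ?Tmap_id// => r /=.
  by rewrite !mxE !eqxx mulr1.
rewrite -(@Tmap_comp _ _ _ _ _ _ \0) ?Tmap_zero// => r /=.
by rewrite !mxE (negbTE jk) andbF mulr0.
Qed.

Lemma presentation M : fin_gen_module M -> exists m (g : {linear 'rV[R]_m -> M}),
  [/\ short_exact (val : {linear subm (kerp g) -> 'rV[R]_m}) g & fin_gen_module (subm (kerp g))].
Proof.
move=> /fin_gen_cover[m [g g_surj]]; exists m, g; split.
  split; [exact: val_inj | exact: g_surj | move=> x; exact/eqP/(valP x) |].
  move=> x x0; have xk : x \in kerp g by rewrite unfold_in; apply/eqP.
  by exists (Sub x xk).
exact/fin_gen_subm/noetherian_fin_gen/fin_gen_rV.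
Qed.

(** In degree 0 left exactness takes the place of the connecting map. *)
Lemma vanish_or_lift n K P M (i : {linear K -> P}) (g : {linear P -> M}) (x : T n M) :
  short_exact i g -> fin_gen_module P -> Tmap n g x = 0 ->
  x = 0 \/ exists n', n = n'.+1 /\
    exists y : T n' K, forall s u, s *: y = Tmap n' i u -> s *: x = 0.
Proof.
case: n x => [|n] x ig hP gx0.
  by left; apply: Tmap0_inj gx0; case: ig.
by right; exists n; split=> //; apply: T_connecting ig hP gx0.
Qed.

(** The cokernel of T n P -> T n K vanishes at p.  The map eval y : K -> T n R
    is, after multiplication by s, the restriction of some eval u; so
    s y - i^* u vanishes on a free cover of K and comes from the next syzygy K'.
    There the induction hypothesis applies, as Ext^j(K, N) and Ext^(j+1)(M, N)
    agree for j > 0. *)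
Lemma killed_coker n K M m (i : {linear K -> 'rV[R]_m}) (g : {linear 'rV[R]_m -> M}) :
  short_exact i g -> fin_gen_module K ->
  (forall j, (j <= n)%N -> killed p (Ext j.+1 M (T (n - j) R^o))) ->
  forall y : T n K, exists s, s \notin sval p /\ exists u, s *: y = Tmap n i u.
Proof.
elim/ltn_ind: n K M m i g => n IHn K M m i g ig hK kE y.
have kE0 : killed p (Ext 1 M (T n R^o)) by have := kE 0 (leq0n _); rewrite subn0.
have [s [sp [w sw]]] := hom_extends (eval y) ig kE0.
have [u uw] := eval_surj w; pose y1 := s *: y - Tmap n i u.
have y1_0 x : eval y1 x = 0.
  have -> : eval y1 x = s *: eval y x - eval (Tmap n i u) x.
    by rewrite /= linearB linearZ.
  by rewrite eval_map uw sw subrr.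
have [m' [g' [ig' hK']]] := presentation hK.
have g'y1 : Tmap n g' y1 = 0 by apply: eval_inj => j; rewrite eval_map y1_0.
have [/subr0_eq y1E|[n' [nE [y' y'P]]]] := vanish_or_lift ig' (fin_gen_rV _ _) g'y1.
  by exists s; split=> //; exists u.
subst n; have [|s' [s'p [u' s'u']]] :=
  IHn n' (ltnSn n') _ _ _ _ _ ig' hK' _ y'.
  move=> j jn; have kEj := kE j.+1 jn; rewrite subSS in kEj.
  exact (Ext_killed_shift ig (@rV_projective R m) kEj).
exists (s' * s); split; first exact: notin_primeM.
exists (s' *: u); rewrite -scalerA [RHS]linearZ /=; apply: subr0_eq.
by rewrite -scalerBr; apply: y'P s'u'.
Qed.

(** The part of the descent that involves Hom(M, T n R) = Ext^0 rather than
    Ext^1; the rest is killed_coker. *)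
Theorem killed_of_Ext n M : fin_gen_module M ->
  (forall i, (i <= n)%N -> killed p (Ext (n - i) M (T i R^o))) -> killed p (T n M).
Proof.
move=> hM kE x; have [m [g [ig hK]]] := presentation hM.
have kE0 : killed p (Ext 0 M (T n R^o)) by have := kE n (leqnn n); rewrite subnn.
have [s sp sx] := hom_killed (eval x) kE0.
have gsx : Tmap n g (s *: x) = 0.
  apply: eval_inj => j; rewrite eval_map -[RHS](sx (g (delta_mx 0 j))) /=.
  by rewrite linearZ.
have [sx0|[n' [nE [y yP]]]] := vanish_or_lift ig (fin_gen_rV _ _) gsx.
  by exists s.
subst n; have [|s' [s'p [u s'u]]] := killed_coker ig hK _ y.
  move=> j jn; have := kE (n' - j)%N (leq_trans (leq_subr _ _) (leqnSn _)).
  by rewrite subSn ?leq_subr// subKn.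
by exists (s' * s); [exact: notin_primeM | rewrite -scalerA; apply: yP s'u].
Qed.

(** T n P is a finite sum of copies of T n R, and the connecting map lowers
    the degree. *)
Theorem killed_of_ring n M : fin_gen_module M ->
  (forall i, (i <= n)%N -> killed p (T i R^o)) -> killed p (T n M).
Proof.
elim/ltn_ind: n M => n IHn M hM kT x; have [m [g [ig hK]]] := presentation hM.
have [s sp sx] := killed_seq
  [seq eval (Tmap n g x) (delta_mx 0 j) | j <- enum 'I_m] (kT n (leqnn n)).
have gsx : Tmap n g (s *: x) = 0.
  rewrite linearZ; apply: eval_inj => j; rewrite -[RHS](sx (eval (Tmap n g x) (delta_mx 0 j))).
    by rewrite /= linearZ.
  by apply: map_f; rewrite mem_enum.
have [sx0|[n' [nE [y yP]]]] := vanish_or_lift ig (fin_gen_rV _ _) gsx.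
  by exists s.
subst n; have [|s' s'p s'y] := IHn n' (ltnSn n') _ hK _ y.
  by move=> j jn; apply: kT; apply: leqW.
exists (s' * s); first exact: notin_primeM.
by rewrite -scalerA; apply: (yP s' 0); rewrite linear0.
Qed.

End Chase.

(** * The supports of generalized local cohomology *)

(** The supremum is the maximum of B if B is bounded, and +oo otherwise. *)
Lemma nat_ereal_supremums (B : set nat) i : B i ->
  supremums [set j%:Z%:E | j in B] !=set0.
Proof.
move=> Bi; have [[b Bb]|nb] := pselect (exists b, forall j, B j -> (j <= b)%N).
  have exB : exists j, `[< B j >] by exists i; apply/asboolP.
  have [j /asboolP jB|m /asboolP mB maxm] := @ex_maxnP (fun j => `[< B j >]) b exB.
    exact: Bb.
  exists m%:Z%:E; split=> [_ [j jB <-]|y ym]; last by apply: ym; exists m.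
  by rewrite lee_fin lez_nat; apply/maxm/asboolP.
exists +oo%E; split=> [_ [j jB <-]|y yB]; first exact: leey.
case: y yB => [r| |] yB //; last by have := yB _ (ex_intro2 _ _ i Bi erefl).
exfalso; apply: nb; exists (absz r) => j jB.
have := yB _ (ex_intro2 _ _ j jB erefl); rewrite lee_fin.
by case: r {yB}.
Qed.

Unset Implicit Arguments.

Theorem corollary3p5 (R : comNzRingType) (hR : noetherian R)
    (a : submodClosed R^o) (M X : lmodType R) (hM : fin_gen_module M)
    (n : nat) :
  [/\ Supp (gen_local_cohomology a n M X) `<=`
        \bigcup_(i in [set i : nat | (i <= n)%N])
          Supp (Ext (n - i) M (local_cohomology a i X)),
      \bigcup_(i in [set i : nat | (i <= n)%N])
          Supp (gen_local_cohomology a i M X) `<=`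
        \bigcup_(i in [set i : nat | (i <= n)%N])
          Supp (local_cohomology a i X)
    & Supp (gen_local_cohomology a n M X) `<=`
        \bigcup_(i in [set i : nat |
              (i%:Z%:E <= cohomological_dimension a X)%E])
          Supp (local_cohomology a i X)].
Proof.
have Hc n' K P M' i g x ig hP :=
  @glc_connecting R a X K P M' i g ig n' x hR hP.
have ofring m p : (forall i, (i <= m)%N -> ~ Supp (local_cohomology a i X) p) ->
    ~ Supp (gen_local_cohomology a m M X) p.
  move=> nS; apply/killed_Supp.
  apply: (killed_of_ring (T := glc a X) (@glc_map_lin R a X) (@glc_map_comp R a X)
    (@glc_map_id R a X) (@glc_map0_inj R a X) Hc hR hM) => i im.
  exact/killed_Supp/nS.
have b m : Supp (gen_local_cohomology a m M X) `<=`
    \bigcup_(i in [set i : nat | (i <= m)%N]) Supp (local_cohomology a i X).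
  move=> p pM; apply: contrapT => nS; apply: ofring pM => i im pi.
  by apply: nS; exists i.
split.
- move=> p pM; apply: contrapT => nS; move: pM; apply/killed_Supp.
  apply: (killed_of_Ext (T := glc a X) (@glc_map_lin R a X) (@glc_map_comp R a X)
    (@glc_map_id R a X) (@glc_map0_inj R a X) Hc hR hM) => i im.
  by apply/killed_Supp => pi; apply: nS; exists i.
- move=> p [i /= im /b[j /= ji pj]]; exists j => //=.
  exact: leq_trans ji im.
- move=> p /b[i _ pi]; exists i => //=.
  have xi : exists x : local_cohomology a i X, x <> 0.
    apply: contrapT => n0; move: pi; apply/killed_Supp => x.
    exists 1; first exact: notin_prime1.
    by rewrite scale1r; apply: contrapT => x0; apply: n0; exists x.
  apply: ge_supremum_Nmem; first exact: nat_ereal_supremums xi.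
  by exists i.
Qed.
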